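(* Let $p\in\mathbb{T}\mathbb{R}[x]$. Then there exists a polynomial $P\in\mathbb{R}[[t^{\mathbb{R}}]][x]$ with $v_{\mathbb{R}}(P)=p$ (coefficientwise) such that for each edge $\sigma$ of the Newton polygon of $P$, with slope $-|a|$ where $a\in\mathbb{T}\mathbb{R}$ has sign $+1$, $P$ has exactly $\operatorname{mult}_a(p(x))$ (respectively $\operatorname{mult}_a(p(-x))$) roots in $\mathbb{C}[[t^{\mathbb{R}}]]$, counted with multiplicity, of valuation $|a|$ whose leading term is real and positive (respectively real and negative).
   Context: For $k=\mathbb{R},\mathbb{C}$, $k[[t^{\mathbb{R}}]]$ is the field of Hahn series $\sum_{\gamma\in I}a_\gamma t^\gamma$ ($a_\gamma\in k$, $I\subset\mathbb{R}$ well-ordered). For nonzero such series with $\gamma_0=\min\{\gamma:a_\gamma\ne0\}$, the valuation is $\gamma_0$, the leading term is $a_{\gamma_0}t^{\gamma_0}$, and for real series $v_{\mathbb{R}}(\sum a_\gamma t^\gamma)=(\operatorname{sign}(a_{\gamma_0}),\gamma_0)$, $v_{\mathbb{R}}(0)=\infty$. The signed tropical hyperfield $\mathbb{T}\mathbb{R}$ has underlying set $(\{\pm1\}\times\mathbb{R})\cup\{\infty\}$, zero $\infty$, unit $(+1,0)$, multiplication $(s,r)(s',r')=(ss',r+r')$, $\infty\cdot x=\infty$; for $x=(s,r)$, $|x|=r$, $-x=(-s,r)$. Hyperaddition: $x\boxplus\infty=\{x\}$, and $(s,r)\boxplus(s',r')$ equals $\{(s,r)\}$ if $r<r'$, $\{(s',r')\}$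 if $r'<r$, $\{(s,r)\}$ if $r=r'$, $s=s'$, and $\{(\pm1,t):t\ge r\}\cup\{\infty\}$ if $r=r'$, $s=-s'$; iterated sums are unions as usual. The Newton polygon of $P=\sum c_ix^i$ is the lower convex hull of $\{(i,v(c_i))\}$; edges are bounded edges. For $q=\sum c_ix^i$ over $\mathbb{T}\mathbb{R}$, $q(-x)=\sum (-1)^ic_ix^i$ (with $-1=(-1,0)$). For a polynomial $q=\sum_{i=0}^n c_ix^i$ over $\mathbb{T}\mathbb{R}$ and $b\in\mathbb{T}\mathbb{R}$: $b$ is a root if $\infty\in\boxplus_i c_ib^i$; $q\in(x-b)s$ with $s=\sum_{i=0}^{n-1}d_ix^i$ means $c_0=-bd_0$, $c_i\in(-bd_i)\boxplus d_{i-1}$ for $1\le i\le n-1$, $c_n=d_{n-1}$; and $\operatorname{mult}_b(q)=0$ if $b$ is not a root, otherwise $1+\max\{\operatorname{mult}_b(s):q\in(x-b)s\}$. *)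

(* Defs.v *)
From HB Require Import structures.
From mathcomp Require Import all_boot all_order all_algebra.
From mathcomp Require Import boolp classical_sets fsbigop reals.
From mathcomp Require Import complex.

Set Implicit Arguments.
Unset Strict Implicit.
Unset Printing Implicit Defensive.

Import Order.TTheory GRing.Theory Num.Theory.
Local Open Scope classical_set_scope.
Local Open Scope ring_scope.

(* [TInf] is infinity (the zero); [TFin s r] is (sign, r) with
   s = true meaning sign +1 and s = false meaning sign -1. *)
Inductive TR (R : Type) : Type :=
| TInf : TR R
| TFin : bool -> R -> TR R.
Arguments TInf {R}.

Section Tropical.
Variable R : realType.

Definition tone : TR R := TFin true 0.

Definition tmul (x y : TR R) : TR R :=
  match x, y with
  | TFin s r, TFin s' r' => TFin (s == s') (r + r')
  | _, _ => TInf
  end.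

Definition topp (x : TR R) : TR R :=
  match x with TFin s r => TFin (~~ s) r | TInf => TInf end.

Definition tabs (x : TR R) : R := match x with TFin _ r => r | TInf => 0 end.

Fixpoint texp (x : TR R) (n : nat) : TR R :=
  match n with 0 => tone | n'.+1 => tmul x (texp x n') end.

Definition thadd (x y : TR R) : set (TR R) :=
  match x, y with
  | TInf, _ => [set y]
  | _, TInf => [set x]
  | TFin s r, TFin s' r' =>
      if r < r' then [set x]
      else if r' < r then [set y]
      else if s == s' then [set x]
      else [set z | z = TInf \/ exists s'' t, z = TFin s'' t /\ r <= t]
  end.

Fixpoint thsum (l : seq (TR R)) : set (TR R) :=
  match l with
  | [::] => [set TInf]
  | x :: l' => \bigcup_(y in thsum l') thadd x y
  end.

(* A polynomial over TR is the list of its coefficients c_0, ..., c_n. *)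
Definition tcoef (q : seq (TR R)) (i : nat) : TR R := nth TInf q i.

Definition teval_terms (q : seq (TR R)) (b : TR R) : seq (TR R) :=
  [seq tmul (tcoef q i) (texp b i) | i <- iota 0 (size q)].

Definition troot (b : TR R) (q : seq (TR R)) : Prop :=
  thsum (teval_terms q b) TInf.

(* q \in (x - b) s, with q of degree n >= 1 and s of degree n - 1 *)
Definition tdiv (q : seq (TR R)) (b : TR R) (s : seq (TR R)) : Prop :=
  let n := size s in
  (0 < n)%N /\ size q = n.+1 /\
  tcoef q 0 = tmul (topp b) (tcoef s 0) /\
  (forall i, (1 <= i <= n.-1)%N ->
     thadd (tmul (topp b) (tcoef s i)) (tcoef s i.-1) (tcoef q i)) /\
  tcoef q n = tcoef s n.-1.

(* mult_ge b q m : "mult_b(q) >= m", unfolding the recursive definition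
   mult_b(q) = 0 if b is not a root of q,
             = 1 + max { mult_b(s) : q \in (x - b) s } otherwise
   (with the max of an empty set taken to be 0). *)
Fixpoint mult_ge (b : TR R) (q : seq (TR R)) (m : nat) : Prop :=
  match m with
  | 0 => True
  | m'.+1 => troot b q /\
             (m' = 0%N \/ exists s, tdiv q b s /\ mult_ge b s m')
  end.

(* mult_b(q): the largest m with mult_ge b q m (it is at most size q + 1,
   since every division lowers the length by one). *)
Definition tmult (b : TR R) (q : seq (TR R)) : nat :=
  \max_(m < (size q).+2 | `[< mult_ge b q m >]) m.

Definition tneg_var (q : seq (TR R)) : seq (TR R) :=
  [seq tmul (texp (topp tone) i) (tcoef q i) | i <- iota 0 (size q)].

End Tropical.

(* Hahn series k[[t^R]] (k = R or C = R[i]) as functions R -> k with  *)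
(* well-ordered support                                                *)

Section Hahn.
Variable R : realType.

Definition well_ordered (A : set R) : Prop :=
  forall B, B `<=` A -> B !=set0 -> exists b, B b /\ forall x, B x -> b <= x.

Definition is_hahn (K : nmodType) (f : R -> K) : Prop :=
  well_ordered [set g | f g != 0].

Definition hval (K : nmodType) (f : R -> K) (g : R) : Prop :=
  f g != 0 /\ forall d, f d != 0 -> g <= d.

Definition vR (f : R -> R) (x : TR R) : Prop :=
  (x = TInf /\ forall g, f g = 0) \/
  (exists g, hval f g /\ x = TFin (0 < f g) g).

Definition hzero (K : nmodType) : R -> K := fun _ => 0.
Definition hone (K : pzSemiRingType) : R -> K := fun g => if g == 0 then 1 else 0.
Definition hsub (K : zmodType) (f h : R -> K) : R -> K := fun g => f g - h g.

(* Product of Hahn series: (f h)(g) = sum_{a + b = g} f(a) h(b)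
   (a finite sum when f and h have well-ordered support). *)
Definition hmul (K : pzRingType) (f h : R -> K) : R -> K := fun g =>
  \sum_(ab \in [set ab : R * R | f ab.1 != 0 /\ h ab.2 != 0 /\ ab.1 + ab.2 = g])
     f ab.1 * h ab.2.

(* Polynomials over Hahn series, as coefficient lists c_0, ..., c_n. *)
Definition hcoef (K : nmodType) (P : seq (R -> K)) (i : nat) : R -> K :=
  nth (@hzero K) P i.

(* coefficients of (x - r) * Q *)
Definition mul_lin (K : pzRingType) (r : R -> K) (Q : seq (R -> K)) : seq (R -> K) :=
  [seq hsub (if (0 < i)%N then hcoef Q i.-1 else @hzero K) (hmul r (hcoef Q i)) | i <- iota 0 (size Q).+1].

Definition prod_lin (K : pzRingType) (rs : seq (R -> K)) : seq (R -> K) :=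
  foldr (@mul_lin K) [:: @hone K] rs.

Definition hcomplex (f : R -> R) : R -> R[i] := fun g => Complex (f g) 0.

(* Newton polygon: (i, j), i < j, is an edge of the lower convex hull of
   { (k, v(c_k)) : c_k <> 0 }, with slope lam. *)
Definition newton_edge (P : seq (R -> R)) (i j : nat) (lam : R) : Prop :=
  (i < j)%N /\
  exists vi vj, hval (hcoef P i) vi /\ hval (hcoef P j) vj /\
    lam = (vj - vi) / (j%:R - i%:R) /\
    (forall k vk, hval (hcoef P k) vk ->
        vi + (k%:R - i%:R) * lam <= vk /\
        (vk = vi + (k%:R - i%:R) * lam -> (i <= k <= j)%N)).

End Hahn.

(* Main.v *)
(* The lift has the monomial coefficients [s_k B^(-k^2) t^(v_k)], where
   [(s_k, v_k)] is the k-th coefficient of [p] and [B > n^3] for a list of [n]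
   coefficients.

   On an edge of the Newton polygon, the initial form is a real polynomial with
   coefficients [s_k B^(-k^2)]. At any root only two of its terms are of
   comparable size, so its nonzero complex roots are simple. Its sign at
   [B^(2k)] is [s_k] for every nonzero coefficient, so it has at least as many
   positive roots as sign changes, hence exactly as many by Descartes' rule.
   The same holds for its negative roots after substituting [-x].

   Simple roots lift by Hensel's lemma to series with left-finite support,
   which form a complete integral domain. Every unit step between the extreme
   exponents lies below some edge, so the lifts over all the edges, together
   with the root 0, exhaust the roots.

   On the tropical side, [mult_a(p)] is also the number of sign changes along
   the edge: dividing by [x - a] removes at least one sign change, as in
   Descartes' rule, and a suitable quotient removes exactly one. *)

(* The exponents [-k^2] are chosen because the terms of index [i] and [j] then have equal modulus
   exactly where the variable has modulus [B^(i+j)]. For three indices these moduli are at least a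
   factor [B] apart, so three terms are never comparable. This holds for any subset of the
   coefficients and any signs, so one [B] serves all edges and both [x] and [-x].

   Both upper bounds rest on one combinatorial lemma: the signs of a real product by [X - z] with
   [z > 0] and those of a tropical product by [x - 1] obey the same relation in the hyperfield of
   signs.

   The polynomial is shown to split by counting: an edge from [i] to [j] yields [j - i] lifts with
   distinct leading terms, and the edge lengths add up to the degree minus the order at 0.
   Left-finite supports make the coefficients of products finite sums with explicit bounds, and
   limits can be taken coefficientwise. *)
Require Import Defs.
From HB Require Import structures.
From mathcomp Require Import all_boot all_order all_algebra.
From mathcomp Require Import boolp classical_sets cardinality fsbigop reals.
From mathcomp Require Import complex polyrcf separable finmap.
From mathcomp Require Import zify ring lra.
Import Order.TTheory GRing.Theory Num.Theory.
Set Implicit Arguments.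
Unset Strict Implicit.
Unset Printing Implicit Defensive.
Local Open Scope ring_scope.

(** * Sign changes *)

(* The element [u] is the last nonzero sign seen so far; [None] stands for
   a zero coefficient. *)
Fixpoint sign_changes (u : option bool) (l : seq (option bool)) : nat :=
  match l with
  | [::] => 0
  | None :: l' => sign_changes u l'
  | Some b :: l' => (u == Some (~~ b)) + sign_changes (Some b) l'
  end.

(* [z] belongs to the hypersum of [x] and [y] in the hyperfield of signs. *)
Definition sign_hadd (x y z : option bool) : bool :=
  match x, y with
  | None, _ => z == y
  | _, None => z == x
  | Some a, Some b => (a == b) ==> (z == x)
  end.

(* The signs [ss] are those of a multiple by [X - 1] of a polynomial whose
   next lower coefficient is [p] and whose remaining coefficients are [ts]. *)
Fixpoint sign_div (p : option bool) (ts ss : seq (option bool)) : bool :=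
  match ts, ss with
  | [::], [:: s] => s == p
  | t :: ts', s :: ss' => sign_hadd (omap negb t) p s && sign_div t ts' ss'
  | _, _ => false
  end.

(** As long as the last sign of the product is opposite to [p], one more change is still to come,
    since product and quotient end with the same sign. Otherwise that change may be spent already
    and only the weak bound remains. The last clause is the goal, the others are the invariants of
    the induction. *)
Lemma sign_changes_div p ts ss : sign_div p ts ss ->
  [/\ forall b, p = Some b ->
        (sign_changes (Some b) ts < sign_changes (Some (~~ b)) ss)%N,
      forall b u, p = Some b ->
        (sign_changes (Some b) ts <= sign_changes u ss)%N,
      forall u v, p = None -> (sign_changes v ts <= sign_changes u ss)%N &
      p = None -> has isSome ts ->
        (sign_changes None ts < sign_changes None ss)%N].
Proof.
elim: ts p ss => [|t ts IH] p [|s ss] //=.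
  by case: ss => // /eqP ->; split => //= b ->; rewrite eqxx.
case/andP => st /IH [H1 H2 H3 H4].
have {}H1 b : t = Some b -> (sign_changes t ts < sign_changes (Some (~~ b)) ss)%N.
  by move=> tb; rewrite tb; exact: H1.
have {}H2 u : t != None -> (sign_changes t ts <= sign_changes u ss)%N.
  by case: t H2 {st H1 H3 H4} => // b H2 _; exact: H2.
split.
- move=> b pb; rewrite {}pb in st.
  case: t st H1 H2 H3 {H4} => [c|] /=; case: s => [d|] //= st H1 H2 H3.
  + have := H1 _ erefl; have := H2 (Some d) isT; move: st.
    by case: b; case: c {H1 H2 H3}; case: d => //=; lia.
  + by have := H2 (Some (~~ b)) isT; have := H1 _ erefl; move: st;
      case: b; case: c {H1 H2 H3} => //=; lia.
  + by move/eqP: st => [->]; rewrite eqxx add1n ltnS; exact: H3.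
- move=> b u pb; rewrite {}pb in st.
  case: t st H1 H2 H3 {H4} => [c|] /=; case: s => [d|] //= st H1 H2 H3.
  + have := H1 _ erefl; have := H2 (Some d) isT; move: st.
    by case: b; case: c {H1 H2 H3}; case: d => //=; lia.
  + by have := H2 u isT; have := H1 _ erefl; move: st;
      case: b; case: c {H1 H2 H3} => //=; lia.
  + exact: leq_trans (H3 _ _ erefl) (leq_addl _ _).
- move=> u v pb; rewrite {}pb in st.
  case: t st H1 H2 H3 {H4} => [c|] /=; case: s => [d|] //= /eqP st H1 H2 H3.
  + case: st => ->; have := H1 _ erefl; have := leq_b1 (v == Some (~~ c)); lia.
  + exact: H3.
- move=> pb; rewrite {}pb in st.
  case: t st H1 H2 H3 H4 => [c|] /=; case: s => [d|] //= /eqP st H1 H2 H3 H4.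
  + by case: st => ->; move=> _; have := H1 _ erefl; lia.
  + exact: H4.
Qed.

Lemma sign_changes_cst u l : sign_changes u l = 0%N -> u <> None ->
  forall x, x \in l -> x = None \/ x = u.
Proof.
elim: l u => [|[b|] l IH] u //=.
- case: u => // c /eqP; rewrite addn_eq0 eqb0 => /andP[cb /eqP /IH H] _ x.
  have {cb} cb : c = b by case: b c cb {H} => -[].
  by rewrite inE cb => /orP[/eqP ->|/H []] //; auto.
- by move=> /IH H /H {}H x; rewrite inE => /orP[/eqP ->|/H //]; left.
Qed.

Lemma sign_changes_None l : sign_changes None l = 0%N ->
  exists s, forall x, x \in l -> x = None \/ x = Some s.
Proof.
elim: l => [|[b|] l IH] /=; first by exists true.
- move/sign_changes_cst => H; exists b => x.
  by rewrite inE => /orP[/eqP ->|/H []] //; auto.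
- by move=> /IH [s H]; exists s => x; rewrite inE => /orP[/eqP ->|/H //]; left.
Qed.

Lemma sign_changes_Some_gt0 s l : (0 < sign_changes (Some s) l)%N ->
  Some (~~ s) \in l.
Proof.
elim: l => //= -[b|] l IH; rewrite inE.
- case: eqP => [[->] _|]; first by rewrite negbK eqxx.
  by case: b s IH => -[] //= IH _ /IH ->; rewrite orbT.
- by move/IH ->; rewrite orbT.
Qed.

Lemma sign_changes_gt0 l : (0 < sign_changes None l)%N ->
  forall s, Some s \in l.
Proof.
elim: l => //= -[b|] l IH.
- rewrite add0n => /sign_changes_Some_gt0 H s; rewrite inE.
  by have [->|] := eqVneq s b; rewrite ?eqxx //; case: s b H => -[] // -> ; rewrite orbT.
- by move/IH => H s; rewrite inE H orbT.
Qed.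

Lemma sign_changes_size u l : (sign_changes u l <= size l)%N.
Proof.
elim: l u => //= -[b|] l IH u; last exact: leqW.
by rewrite -(add1n (size l)) leq_add ?leq_b1.
Qed.

Lemma sign_changes_nones u l : (forall x, x \in l -> x = None) -> sign_changes u l = 0%N.
Proof.
elim: l => //= x l IH H; rewrite (H x (mem_head _ _)); apply: IH => y yl.
by apply: H; rewrite inE yl orbT.
Qed.

Lemma sign_div_None ts ss : sign_div None ts ss -> has isSome ss -> has isSome ts.
Proof.
suff H p : sign_div p ts ss -> has isSome ss -> isSome p || has isSome ts by exact: H.
elim: ts p ss => [|t ts IH] p [|s ss] //=; first by case: ss => // /eqP -> /=; case: p.
case/andP => st /IH H; case: t st H => [b|] /=; first by rewrite orbT.
case: p => // /eqP -> H; exact: H.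
Qed.

(** The inductive step of Descartes' rule, shared by the bounds for tropical multiplicities and for
    positive real roots. *)
Lemma sign_changes_quotient ts ss : sign_div None ts ss -> has isSome ss ->
  (sign_changes None ts < sign_changes None ss)%N.
Proof.
move=> H Hs; have [_ _ _] := sign_changes_div H; apply=> //.
exact: sign_div_None H Hs.
Qed.

(** * Multiplicities over the signed tropical hyperfield *)

Section TropicalSigns.
Variable R : realType.
Implicit Types (x y z p : TR R) (xs es : seq (TR R)) (mu rho : R).

Definition val_ge mu x := match x with TFin _ v => mu <= v | TInf => true end.

(* The sign of the coefficient of [t^mu] in a series of valuation at least
   [mu] that is mapped to [x]. *)
Definition sign_at mu x : option bool :=
  match x with TFin s v => if v == mu then Some s else None | TInf => None end.

(** Taking the coefficient of [t^mu] respects hypersums: terms above [mu] become zero, a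
    cancellation at [mu] permits every sign there, and one above [mu] leaves zero. *)
Lemma sign_at_hadd mu x y z : val_ge mu x -> val_ge mu y -> thadd x y z ->
  val_ge mu z /\ sign_hadd (sign_at mu x) (sign_at mu y) (sign_at mu z).
Proof.
case: x y => [|s r] [|s' r'] /= hr hr'; try (move=> -> /=; split => //).
  by case: ifP => _ /=; rewrite ?eqxx.
have [rr'|rr'|rr'] := ltgtP r r'.
- move=> -> /=; split => //; have ->: (r' == mu) = false.
    by apply/negbTE; rewrite gt_eqF // (le_lt_trans hr).
  by case: ifP => _ /=; rewrite ?eqxx.
- move=> -> /=; split => //; have ->: (r == mu) = false.
    by apply/negbTE; rewrite gt_eqF // (le_lt_trans hr').
  by case: ifP => _ /=; rewrite ?eqxx.
- rewrite -{}rr'; case: (eqVneq s s') => [->|ss'].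
    by move=> -> /=; split => //; case: ifP => //=; rewrite !eqxx.
  case=> [-> /=|[s'' [t [-> /= rt]]]]; split => //.
  + by case: eqP => //=; rewrite (negbTE ss').
  + exact: le_trans hr rt.
  + case: (eqVneq r mu) => [_|rmu] /=; first by rewrite (negbTE ss').
    by case: (eqVneq t mu) => // tmu; move: rmu; rewrite eq_le hr -tmu rt.
Qed.

Lemma sign_at_opp mu x : sign_at mu (topp x) = omap negb (sign_at mu x).
Proof. by case: x => //= s r; case: ifP. Qed.

Lemma val_ge_opp mu x : val_ge mu (topp x) = val_ge mu x.
Proof. by case: x. Qed.

(* The list form of [tdiv _ tone _], with the next lower coefficient [p] of
   the quotient carried along. *)
Fixpoint tropical_div p es xs : Prop :=
  match es, xs with
  | [::], [:: x] => x = p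
  | e :: es', x :: xs' => thadd (topp e) p x /\ tropical_div e es' xs'
  | _, _ => False
  end.

(** A quotient coefficient of valuation below [mu] would dominate [p] and appear, up to sign, in the
    product; so the bound passes on to the quotient. *)
Lemma tropical_div_sign mu p es xs : tropical_div p es xs ->
  val_ge mu p -> all (val_ge mu) xs ->
  all (val_ge mu) es /\
  sign_div (sign_at mu p) (map (sign_at mu) es) (map (sign_at mu) xs).
Proof.
elim: es p xs => [|e es IH] p [|x xs] //=; first by case: xs => // -> _ _ /=.
case=> xep /IH {}IH gp /andP[gx gxs].
have ge : val_ge mu e.
  case: e xep {IH} => //= s r xep; rewrite leNgt; apply/negP => rmu.
  case: p gp xep => [_|s' r' gp] /= xep; first by move: gx; rewrite xep /= leNgt rmu.
  by move: xep; rewrite (lt_le_trans rmu gp) => xep; move: gx; rewrite xep /= leNgt rmu.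
have [-> ->] := IH ge gxs; rewrite ge andbT; split => //.
have ge' : val_ge mu (topp e) by rewrite val_ge_opp.
by rewrite andbT -sign_at_opp; have [] := sign_at_hadd ge' gp xep.
Qed.

Lemma thsum_val_ge mu xs y : all (val_ge mu) xs -> thsum xs y -> val_ge mu y.
Proof.
elim: xs y => [|x xs IH] y /=; first by move=> _ ->.
by case/andP=> gx gxs [z /(IH _ gxs) gz /(sign_at_hadd gx gz)[]].
Qed.

(** Equal signs at height [mu] cannot cancel. Hence, if some term has height [mu], a root forces a
    sign change. *)
Lemma thsum_sign mu s xs y : all (val_ge mu) xs ->
  (forall o, o \in map (sign_at mu) xs -> o = None \/ o = Some s) ->
  thsum xs y ->
  sign_at mu y = if has isSome (map (sign_at mu) xs) then Some s else None.
Proof.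
elim: xs y => [|x xs IH] y /=; first by move=> _ _ ->.
move=> /andP[gx gxs] H [z hz xyz].
have gz := thsum_val_ge gxs hz.
have [_] := sign_at_hadd gx gz xyz.
rewrite {IH}(IH _ gxs _ hz) => [|o ho]; last by apply: H; rewrite inE ho orbT.
have [->|->] := H _ (mem_head _ _) => /=; first by move/eqP.
by case: ifP => _ /=; rewrite ?eqxx => /eqP.
Qed.

Lemma thadd_nonempty x y : exists z, thadd x y z.
Proof.
case: x y => [|s r] [|s' r'] /=; try by eexists.
by case: ifP => _; [|case: ifP => _; [|case: ifP => _]]; eexists; try (by []); left.
Qed.

Lemma thsum_nonempty xs : exists y, thsum xs y.
Proof.
elim: xs => [|x xs [y hy]] /=; first by exists TInf.
by have [z hz] := thadd_nonempty x y; exists z; exists y.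
Qed.

Lemma thaddC x y z : thadd x y z -> thadd y x z.
Proof.
case: x y => [|s r] [|s' r'] //=.
by have [//|//|<-] := ltgtP r r'; case: (eqVneq s s') => [->|].
Qed.

Lemma thadd_lt x y s v : y = TFin s v -> (match x with TFin _ w => v < w | TInf => True end) ->
  thadd x y y.
Proof. by move=> ->; case: x => //= s' w vw; rewrite vw lt_gtF. Qed.

Lemma thadd_opp_ge s v z : val_ge v z -> thadd (TFin s v) (TFin (~~ s) v) z.
Proof.
move=> vz; rewrite /= ltxx; have -> : (s == ~~ s) = false by case: s.
by case: z vz => [|s' w] /= ?; [left|right; exists s', w].
Qed.

Lemma thsum_full mu xs z : all (val_ge mu) xs ->
  (forall s, Some s \in map (sign_at mu) xs) -> val_ge mu z -> thsum xs z.
Proof.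
elim: xs z => [|x xs IH] z /=; first by move=> _ /(_ true).
case/andP=> gx gxs H gz.
have [Hxs|] := pselect (forall s, Some s \in map (sign_at mu) xs).
  case: x gx H => [|s v] gx H; first by exists z => //; exact: IH.
  case: (boolP (val_ge v z)) => vz.
    by exists (TFin (~~ s) v); [exact: IH|exact: thadd_opp_ge].
  exists z; first exact: IH.
  by case: z vz gz => //= s' w; rewrite -ltNge => wv _; rewrite wv lt_gtF.
(* The tail lacks the sign [s], so the head carries it. Any element of the hypersum of the tail then
   has sign [~~ s] at [mu], and cancels with the head to everything of valuation at least [mu]. *)
move=> /existsNP[s /negP sxs].
have xs_s : sign_at mu x = Some s by move: (H s); rewrite inE (negbTE sxs) orbF => /eqP.
have Hs' : Some (~~ s) \in map (sign_at mu) xs.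
  by move: (H (~~ s)); rewrite inE xs_s => /orP[/eqP[]|//]; case: (s).
have [y hy] := thsum_nonempty xs.
exists y => //.
have : sign_at mu y = Some (~~ s).
  rewrite (thsum_sign (s := ~~ s) gxs _ hy) => [|o ho].
    by rewrite ifT //; apply/hasP; exists (Some (~~ s)).
  case: o ho => [o|]; last by left.
  move=> ho; right; case: (eqVneq o s) ho => [->|os _]; first by rewrite (negbTE sxs).
  by case: o s os {H sxs xs_s Hs'} => -[].
move: xs_s; rewrite /sign_at; case: x {gx H} => // s' v; case: eqP => // -> [->].
case: y {hy} => // t w; case: eqP => // -> [->].
exact: thadd_opp_ge.
Qed.

Lemma Some_negb (s : bool) : (Some s == Some (~~ s)) = false.
Proof. by case: s. Qed.

(** A solution [p] of: [x] lies in the hypersum of [-e] and [p]. If [x] is not above [e], then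
    [p = x] works; otherwise [p = e] cancels [-e] and the hypersum contains everything higher. It
    fills the quotient away from the edge. *)
Definition tropical_min x y : TR R :=
  match x, y with
  | TInf, _ => y
  | _, TInf => x
  | TFin _ v, TFin _ w => if v <= w then x else y
  end.

Lemma thadd_self s v z : (z = TFin s v) -> thadd (TFin s v) (TFin s v) z.
Proof. by move=> ->; rewrite /= ltxx eqxx. Qed.

Lemma tropical_min_hadd x e : thadd (topp e) (tropical_min x e) x.
Proof.
case: x e => [|s v] [|t w] //=.
  by rewrite ltxx; case: t => /=; left.
have [vw|wv|->] /= := ltgtP v w; rewrite ?ltxx ?vw ?(lt_gtF vw) //.
- case: (t) => /=; right; exists s, v; split => //; exact: ltW.
- by case: (eqVneq (~~ t) s) => [->|_] //=; right; exists s, w.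
Qed.

Local Arguments thadd : simpl never.

Lemma tropical_min_none mu x e :
  val_ge mu x -> sign_at mu x = None -> val_ge mu e -> sign_at mu e = None ->
  val_ge mu (tropical_min x e) /\ sign_at mu (tropical_min x e) = None.
Proof. by case: x e => [|s v] [|t w] //= *; case: (v <= w). Qed.

Lemma sign_at_Some mu x s : sign_at mu x = Some s -> x = TFin s mu.
Proof. by case: x => //= t v; case: eqP => // -> [->]. Qed.

(* Division to the right of the last vertex of the edge. *)
Lemma tropical_div_above mu xs : (0 < size xs)%N -> all (val_ge mu) xs ->
  (forall o, o \in map (sign_at mu) xs -> o = None) ->
  exists p es, [/\ tropical_div p es xs, val_ge mu p, sign_at mu p = None,
    all (val_ge mu) es & forall o, o \in map (sign_at mu) es -> o = None].
Proof.
elim: xs => // x xs IH _ /= /andP[gx gxs] H.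
have x0 : sign_at mu x = None by apply: H; rewrite mem_head.
have [/size0nil xs0|xs_n0] := posnP (size xs); first by rewrite xs0; exists x, [::]; split.
case: IH => // [o ho|e [es [ed ge e0 ges es0]]]; first by apply: H; rewrite inE ho orbT.
have [gp p0] := tropical_min_none gx x0 ge e0.
exists (tropical_min x e), (e :: es); split => //=.
- by split => //; exact: tropical_min_hadd.
- by rewrite ge.
- by move=> o; rewrite inE => /orP[/eqP ->|/es0].
Qed.

Fixpoint first_sign (l : seq (option bool)) : option bool :=
  match l with [::] => None | None :: l' => first_sign l' | o :: _ => o end.

Lemma first_signP l : first_sign l = None -> forall o, o \in l -> o = None.
Proof.
elim: l => //= -[b|] l IH // /IH H o; by rewrite inE => /orP[/eqP ->|/H].
Qed.

Lemma sign_changes_first u l s : first_sign l = Some s ->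
  sign_changes u l = ((u == Some (~~ s)) + sign_changes (Some s) l)%N.
Proof.
elim: l u => //= -[b|] l IH u; last exact: IH.
by move=> [->]; rewrite Some_negb.
Qed.

(* Division from a vertex of sign [s] onwards: each coefficient of the quotient
   takes the sign of the next vertex. *)
Lemma tropical_div_right mu xs s : all (val_ge mu) xs ->
  first_sign (map (sign_at mu) xs) = Some s ->
  exists es, [/\ tropical_div (TFin s mu) es xs, all (val_ge mu) es &
    (sign_changes (Some s) (map (sign_at mu) xs) <=
     sign_changes (Some s) (map (sign_at mu) es))%N].
Proof.
elim: xs s => // x xs IH s /= /andP[gx gxs].
case x_s : (sign_at mu x) => [s'|] /= H.
- case: H x_s => -> x_s; rewrite Some_negb ?add0n.
  have xE := sign_at_Some x_s.
  have [/size0nil xs0|xs_n0] := posnP (size xs); first by rewrite xs0; exists [::].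
  case fxs : (first_sign (map (sign_at mu) xs)) => [t|].
    have [es [ed ges les]] := IH _ gxs fxs.
    exists (TFin t mu :: es); split => /=; last 1 first.
    + by rewrite (sign_changes_first (Some s) fxs) eqxx leq_add2l.
    + split => //; rewrite xE /=.
      have [->|ts] := eqVneq (~~ t) s; first exact: thadd_self.
      have -> : s = t by move: ts; case: (t); case: (s).
      by apply: thaddC; apply: thadd_opp_ge; exact: lexx.
    + by rewrite lexx.
  have [e [es [ed ge e0 ges es0]]] := tropical_div_above xs_n0 gxs (first_signP fxs).
  exists (e :: es); split => /=.
  + split => //; rewrite xE; apply: thadd_lt => //.
    case: (e) e0 ge => //= t v; case: eqP => // /eqP vmu _; by rewrite lt_neqAle eq_sym vmu.
  + by rewrite ge.
  + by rewrite sign_changes_nones //; exact: first_signP.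
- have [es [ed ges les]] := IH _ gxs H.
  exists (TFin s mu :: es); split => /=; last 1 first.
  + by rewrite eqxx Some_negb ?add0n.
  + split => //; apply: thaddC; exact: thadd_opp_ge.
  + by rewrite lexx.
Qed.

(* Division between the first vertex, of sign [s], and the first change of
   sign. *)
Lemma tropical_div_left mu xs s : all (val_ge mu) xs ->
  (0 < sign_changes (Some s) (map (sign_at mu) xs))%N ->
  exists es, [/\ tropical_div (TFin (~~ s) mu) es xs, all (val_ge mu) es &
    ((sign_changes (Some s) (map (sign_at mu) xs)).-1 <=
     sign_changes (Some (~~ s)) (map (sign_at mu) es))%N].
Proof.
elim: xs => // x xs IH /= /andP[gx gxs].
have step : (0 < sign_changes (Some s) (map (sign_at mu) xs))%N ->
  exists es, [/\ thadd (topp (TFin (~~ s) mu)) (TFin (~~ s) mu) x,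
    tropical_div (TFin (~~ s) mu) es xs,
    val_ge mu (TFin (~~ s) mu) && all (val_ge mu) es &
    ((sign_changes (Some s) (map (sign_at mu) xs)).-1 <=
     sign_changes (Some (~~ s)) (map (sign_at mu) (TFin (~~ s) mu :: es)))%N].
  move=> /(IH gxs) [es [ed ges les]]; exists es; split => //=.
  - by apply: thaddC; exact: thadd_opp_ge.
  - by rewrite lexx.
  - by rewrite eqxx (Some_negb (~~ s)) ?add0n.
case x_s : (sign_at mu x) => [s'|] /=; last first.
  by move/step => [es [h1 h2 h3 h4]]; exists (TFin (~~ s) mu :: es).
have [->|ss'] := eqVneq s' s.
  rewrite Some_negb ?add0n.
  by move/step => [es [h1 h2 h3 h4]]; exists (TFin (~~ s) mu :: es).
have s'E : s' = ~~ s by case: s' s ss' {IH step x_s} => -[].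
(* The first change is reached. The incoming quotient coefficient already has the sign [~~ s] of
   this vertex, so [tropical_div_right] takes over and only this change is lost. *)
move=> _; rewrite s'E negbK eqxx add1n /=.
have [||es [ed ges les]] := @tropical_div_right mu (x :: xs) (~~ s); rewrite /= ?gx ?x_s ?s'E //.
exists es; split => //; apply: leq_trans les => /=; rewrite x_s s'E.
exact: leq_addl.
Qed.

(** Before the first vertex the quotient is solved forwards from [p] and stays strictly above [mu].
    At a first vertex of sign [s] the next coefficient has to be of height [mu] and sign [~~ s],
    where [tropical_div_left] starts. *)
Lemma tropical_div_below mu xs p : all (val_ge mu) xs -> val_ge mu p ->
  sign_at mu p = None ->
  (0 < sign_changes None (map (sign_at mu) xs))%N ->
  exists es, [/\ tropical_div p es xs, all (val_ge mu) es &
    ((sign_changes None (map (sign_at mu) xs)).-1 <=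
     sign_changes None (map (sign_at mu) es))%N].
Proof.
elim: xs p => // x xs IH p /= /andP[gx gxs] gp p0.
case x_s : (sign_at mu x) => [s|] /=.
- move=> /(tropical_div_left gxs)[es [ed ges les]].
  exists (TFin (~~ s) mu :: es); split => /=.
  + split => //; rewrite (sign_at_Some x_s) negbK; apply: thaddC; apply: thadd_lt => //.
    case: (p) p0 gp => //= t v; case: eqP => // /eqP vmu _; by rewrite lt_neqAle eq_sym vmu.
  + by rewrite lexx.
  + by rewrite eqxx add0n.
- pose e := topp (tropical_min x (topp p)).
  have [||ge e0] := tropical_min_none gx x_s (_ : val_ge mu (topp p)) _.
  + by rewrite val_ge_opp.
  + by rewrite sign_at_opp p0.
  move=> /(IH e gxs) []; rewrite ?val_ge_opp // ?sign_at_opp ?e0 // => es [ed ges les].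
  exists (e :: es); split => /=.
  + split => //; rewrite /e; have := tropical_min_hadd x (topp p).
    have toppK : forall y, topp (topp y) = y by case=> //= s r; rewrite negbK.
    by rewrite !toppK; exact: thaddC.
  + by rewrite val_ge_opp ge.
  + by rewrite sign_at_opp e0.
Qed.

End TropicalSigns.

(** * Rescaling a root to 1; multiplicities as numbers of sign changes *)

Section TropicalMultiplicity.
Variable R : realType.
Implicit Types (x y z p : TR R) (q : seq (TR R)) (mu rho c : R).

Definition tshift c x := match x with TFin s v => TFin s (v + c) | TInf => TInf end.

Lemma tshiftK c x : tshift (- c) (tshift c x) = x.
Proof. by case: x => //= s v; rewrite addrK. Qed.

Lemma tshift_opp c x : tshift c (topp x) = topp (tshift c x).
Proof. by case: x. Qed.

Lemma thadd_tshift c x y z : thadd x y z -> thadd (tshift c x) (tshift c y) (tshift c z).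
Proof.
case: x y => [|s v] [|t w] /=; try by move=> ->.
rewrite !ltrD2r; case: ifP => _; first by move=> ->.
case: ifP => _; first by move=> ->.
case: ifP => _; first by move=> ->.
case=> [->|[s' [r [-> vr]]]]; [by left|right].
by exists s', (r + c); rewrite lerD2r.
Qed.

Lemma texp_true rho i : texp (TFin true rho) i = TFin true (i%:R * rho).
Proof.
elim: i => [|i IH]; first by rewrite mul0r.
by rewrite /= IH /= mulrSr mulrDl mul1r addrC.
Qed.

Lemma tmul_true x c : tmul x (TFin true c) = tshift c x.
Proof. by case: x => //= s v; rewrite eqb_id. Qed.

Lemma teval_termsE q rho : teval_terms q (TFin true rho) =
  [seq tshift (i%:R * rho) (tcoef q i) | i <- iota 0 (size q)].
Proof. by apply: eq_map => i; rewrite texp_true tmul_true. Qed.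

Lemma tropical_divP p (E X : nat -> TR R) m n :
  tropical_div p [seq E i | i <- iota m n] [seq X i | i <- iota m n.+1] <->
  (forall i, (i < n)%N ->
     thadd (topp (E (m + i)%N)) (if i is j.+1 then E (m + j)%N else p) (X (m + i)%N)) /\
  X (m + n)%N = (if n is j.+1 then E (m + j)%N else p).
Proof.
elim: n m p => [|n IH] m p.
  by rewrite /= addn0; split=> [->|[_ ->]].
have -> : [seq E i | i <- iota m n.+1] = E m :: [seq E i | i <- iota m.+1 n] by [].
have -> : [seq X i | i <- iota m n.+2] = X m :: [seq X i | i <- iota m.+1 n.+1] by [].
split=> [[H /IH [H1 H2]]|[H1 H2]].
  split; last by rewrite addnS -addSn H2; case: (n) => [|j] /=; rewrite ?addn0 ?addSnnS ?addnS.
  case=> [|i]; first by rewrite addn0.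
  by rewrite ltnS => /H1; case: i => [|i]; rewrite !addSnnS ?addn0.
split; first by have := H1 0%N isT; rewrite addn0.
apply/IH; split; last by rewrite addSnnS H2; case: (n) => [|j]; rewrite ?addn0 // addSnnS.
by move=> i ltin; have := H1 i.+1 ltin; case: i {ltin} => [|i]; rewrite !addSnnS ?addn0.
Qed.

(** Substituting [a x] for [x] turns [x - a] into [a (x - 1)]; the factor [a] is absorbed by the
    quotient, hence the weight [i.+1] instead of [i]. *)
Definition quotient_terms rho (s : seq (TR R)) : seq (TR R) :=
  [seq tshift (i.+1%:R * rho) (tcoef s i) | i <- iota 0 (size s)].

Lemma tmul_topp_true rho x : tmul (topp (TFin true rho)) x = tshift rho (topp x).
Proof. by case: x => //= -[] v; rewrite addrC. Qed.

Lemma tdivP q rho s : tdiv q (TFin true rho) s <->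
  [/\ (0 < size s)%N, size q = (size s).+1 &
    tropical_div TInf (quotient_terms rho s) (teval_terms q (TFin true rho))].
Proof.
rewrite teval_termsE /quotient_terms; case: (posnP (size s)) => [s0|s_gt0].
  by split; rewrite /tdiv s0 => -[].
have tshift2 c d x : tshift c (tshift d x) = tshift (d + c) x.
  by case: x => //= t v; rewrite addrA.
have shift1 i : i.+1%:R * rho = rho + i%:R * rho by rewrite mulrSr mulrDl mul1r addrC.
split=> [[_ [sq [h0 [hi hn]]]]|[_ sq]].
  split=> //; rewrite sq tropical_divP !add0n; split; last first.
    by rewrite hn; case: (size s) s_gt0.
  move=> i; rewrite !add0n; case: i => [|i] ilt.
    rewrite shift1 !mul0r addr0 h0 tmul_topp_true -tshift_opp.
    by rewrite /tshift; case: (topp _) => //= t v; rewrite addr0.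
  have /hi : (1 <= i.+1 <= (size s).-1)%N by case: (size s) ilt.
  rewrite tmul_topp_true => /(thadd_tshift (i.+1%:R * rho)).
  by rewrite tshift2 -shift1 tshift_opp add0n.
rewrite sq tropical_divP !add0n => -[H1 H2]; split=> //; split=> //.
have tshiftI c x y : tshift c x = tshift c y -> x = y.
  by move=> e; rewrite -(tshiftK c x) e tshiftK.
split; [|split].
- have := H1 0%N s_gt0; rewrite !add0n => H.
  apply: (@tshiftI (0%:R * rho)); rewrite tmul_topp_true tshift2 -shift1 tshift_opp.
  by move: H; case: (topp _) => [|t v] /= ->.
- move=> [//|i] ilt; have ilt' : (i.+1 < size s)%N by case: (size s) ilt s_gt0.
  have := H1 _ ilt'; rewrite !add0n -tshift_opp (shift1 i.+1) -tshift2.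
  by move/(thadd_tshift (- (i.+1%:R * rho))); rewrite -tmul_topp_true !tshiftK.
- apply: (@tshiftI ((size s)%:R * rho)); rewrite H2.
  by case: (size s) s_gt0.
Qed.

Lemma quotient_terms_sign rho mu s :
  map (sign_at mu) (quotient_terms rho s) =
  map (sign_at (mu - rho)) (teval_terms s (TFin true rho)).
Proof.
rewrite teval_termsE -!map_comp; apply: eq_map => i /=.
case: (tcoef s i) => //= t v; rewrite mulrSr mulrDl mul1r addrA.
by rewrite [in RHS]eq_sym subr_eq eq_sym.
Qed.

Lemma quotient_terms_ge rho mu s :
  all (val_ge mu) (quotient_terms rho s) =
  all (val_ge (mu - rho)) (teval_terms s (TFin true rho)).
Proof.
rewrite teval_termsE !all_map; apply: eq_all => i /=.
case: (tcoef s i) => //= t v; rewrite mulrSr mulrDl mul1r addrA.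
by rewrite lerBlDr.
Qed.

(** A root forces a sign change by [thsum_sign], and every division loses at least one. The quotient
    is again evaluated at [a], at height [mu - rho] because of the absorbed factor, and by
    [sign_div_None] it still has a term there. *)
Lemma mult_ge_sign_changes rho mu q m :
  all (val_ge mu) (teval_terms q (TFin true rho)) ->
  has isSome (map (sign_at mu) (teval_terms q (TFin true rho))) ->
  mult_ge (TFin true rho) q m ->
  (m <= sign_changes None (map (sign_at mu) (teval_terms q (TFin true rho))))%N.
Proof.
elim: m mu q => [//|m IH] mu q gq hq [/= rq H].
have {rq} sc0 : (0 < sign_changes None (map (sign_at mu) (teval_terms q (TFin true rho))))%N.
  rewrite lt0n; apply/eqP => /sign_changes_None [s Hs].
  by have := thsum_sign gq Hs rq; rewrite hq.
case: H => [-> //|[s [/tdivP [s0 sq H] Hm]]].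
have [ges] := tropical_div_sign H isT gq.
rewrite quotient_terms_sign => Hs; have hs := sign_div_None Hs hq.
apply: leq_trans (sign_changes_quotient Hs hq).
by apply: IH => //; rewrite -quotient_terms_ge.
Qed.

Lemma sign_changes_mult_ge rho mu q m :
  all (val_ge mu) (teval_terms q (TFin true rho)) ->
  (m <= sign_changes None (map (sign_at mu) (teval_terms q (TFin true rho))))%N ->
  mult_ge (TFin true rho) q m.
Proof.
elim: m mu q => [//|m IH] mu q gq hm.
have sc0 : (0 < sign_changes None (map (sign_at mu) (teval_terms q (TFin true rho))))%N.
  exact: leq_ltn_trans hm.
split.
  apply: (thsum_full gq) => // s; exact: sign_changes_gt0.
have [->|m0] := posnP m; [by left|right].
have [es [ed ges les]] := tropical_div_below gq (isT : val_ge mu TInf) erefl sc0.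
have size_div p xs : tropical_div p es xs -> size xs = (size es).+1.
  elim: (es) p xs => [|e es' IHe] p [|x xs] //=; first by case: xs.
  by case=> _ /IHe ->.
have szq := size_div _ _ ed; rewrite size_map size_iota in szq.
pose s := [seq tshift (- (i.+1%:R * rho)) (nth TInf es i) | i <- iota 0 (size es)].
have szs : size s = size es by rewrite size_map size_iota.
have qs : quotient_terms rho s = es.
  apply: (@eq_from_nth _ TInf); first by rewrite size_map size_iota szs.
  move=> i; rewrite size_map size_iota szs => ilt.
  rewrite (nth_map 0%N) ?size_iota ?szs // nth_iota // add0n /tcoef.
  rewrite (nth_map 0%N) ?size_iota // nth_iota // add0n.
  by rewrite -{1}(opprK (i.+1%:R * rho)) tshiftK.
(* An empty quotient has no sign change, while [m > 0] of them must remain. *)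
have es0 : (0 < size es)%N.
  rewrite lt0n; apply/eqP => /size0nil es0; move: les hm; rewrite es0 /=.
  rewrite leqn0 => /eqP; case: sign_changes => // -[|k] //= _; first by rewrite ltnS leqNgt m0.
exists s; split; first by apply/tdivP; rewrite qs szs.
apply: (IH (mu - rho)); first by rewrite -quotient_terms_ge qs.
by rewrite -quotient_terms_sign qs; apply: leq_trans les; case: sign_changes hm.
Qed.

(** The hypotheses make [mu] the least valuation among the terms at [a], so the signs counted are
    those of the coefficients on one supporting line of the polygon. *)
Theorem tmult_sign_changes rho mu q :
  all (val_ge mu) (teval_terms q (TFin true rho)) ->
  has isSome (map (sign_at mu) (teval_terms q (TFin true rho))) ->
  tmult (TFin true rho) q =
  sign_changes None (map (sign_at mu) (teval_terms q (TFin true rho))).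
Proof.
move=> gq hq; apply/eqP; rewrite eqn_leq; apply/andP; split.
  by apply/bigmax_leqP => m /asboolP; exact: mult_ge_sign_changes.
set k := sign_changes _ _.
have kq : (k < (size q).+2)%N.
  by rewrite ltnS leqW // (leq_trans (sign_changes_size _ _)) // !size_map size_iota.
rewrite -[k]/(val (Ordinal kq)) /tmult; apply: leq_bigmax_cond.
by apply/asboolP/(sign_changes_mult_ge gq).
Qed.

End TropicalMultiplicity.

(** * Real polynomials with widely separated coefficients *)

Section Descartes.
Variable R : rcfType.
Implicit Types (f : {poly R}) (zs : seq R).

Definition sign_of (x : R) : option bool := if x == 0 then None else Some (0 < x).

(** A positive factor [z] is invisible to signs, so real division by [X - z] gives the relation
    [sign_div] whatever [z] is. *)
Lemma sign_of_hadd (a b z : R) : 0 < z ->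
  sign_hadd (omap negb (sign_of b)) (sign_of a) (sign_of (a - b * z)).
Proof.
move=> z0; rewrite /sign_of; case: (ltgtP b 0) => [b0|b0|->] /=; last first.
- by rewrite mul0r subr0.
- have bz : 0 < b * z by rewrite mulr_gt0.
  case: (ltgtP a 0) => [a0|a0|->] //=.
    by have : a - b * z < 0 by [lra]; move=> h; rewrite lt_eqF // (lt_gtF h).
  by rewrite sub0r oppr_eq0 gt_eqF // oppr_gt0 (lt_gtF bz).
- have bz : b * z < 0 by rewrite nmulr_rlt0.
  case: (ltgtP a 0) => [a0|a0|->] //=.
    by have h : 0 < a - b * z by [lra]; rewrite gt_eqF // h.
  by rewrite sub0r oppr_eq0 lt_eqF // oppr_gt0 bz.
Qed.

Lemma sign_div_iota (E X : nat -> option bool) m n :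
  (forall i, sign_hadd (omap negb (E i.+1)) (E i) (X i)) ->
  X (m + n)%N = E (m + n)%N ->
  sign_div (E m) [seq E i.+1 | i <- iota m n] [seq X i | i <- iota m n.+1].
Proof.
move=> H; elim: n m => [|n IH] m Hn; first by rewrite /= -(addn0 m) Hn.
rewrite -[[seq E i.+1 | i <- iota m n.+1]]/(E m.+1 :: [seq E i.+1 | i <- iota m.+1 n]).
rewrite -[[seq X i | i <- iota m n.+2]]/(X m :: [seq X i | i <- iota m.+1 n.+1]).
by apply/andP; split => //; apply: IH; rewrite addSnnS.
Qed.

(** Each listed root is split off as a factor [X - z], at the cost of at least one sign change.
    Padding the signs with zeros up to [N] keeps the length of a coefficient list whatever the
    degree. *)
Lemma descartes f zs N : f != 0 -> (size f <= N)%N -> uniq zs ->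
  (forall z, z \in zs -> 0 < z /\ root f z) ->
  (size zs <= sign_changes None [seq sign_of f`_i | i <- iota 0 N])%N.
Proof.
elim: zs f N => // z zs IH f N f0 fN /= /andP[zzs uzs] H.
have [z0 /factor_theorem[q fE]] := H _ (mem_head _ _).
have q0 : q != 0 by apply: contraNneq f0 => q0; rewrite fE q0 mul0r.
have sf : size f = (size q).+1 by rewrite fE size_Mmonic ?monicXsubC // size_XsubC addn2.
case: N fN => [|N]; rewrite sf // ltnS => qN.
have fc i : f`_i = (if i is j.+1 then q`_j else 0) - q`_i * z.
  by rewrite fE mulrBr coefB coefMX coefMC; case: i.
pose E i := if i is j.+1 then sign_of q`_j else None.
have Hdiv : sign_div (E 0%N) [seq E i.+1 | i <- iota 0 N] [seq sign_of f`_i | i <- iota 0 N.+1].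
  apply: sign_div_iota => [i|].
    rewrite fc; have := @sign_of_hadd (if i is j.+1 then q`_j else 0) q`_i z z0.
    by case: i => [|i] //; rewrite {2}/sign_of eqxx.
  rewrite add0n fc (nth_default _ qN) mul0r subr0.
  by case: (N) => //=; rewrite /sign_of eqxx.
have hs : has isSome [seq sign_of f`_i | i <- iota 0 N.+1].
  apply/hasP; exists (sign_of (lead_coef f)).
    by apply/mapP; exists (size f).-1; rewrite ?mem_iota ?add0n //= sf /= ltnS.
  by rewrite /sign_of lead_coef_eq0 (negbTE f0).
apply: leq_ltn_trans (sign_changes_quotient Hdiv hs).
apply: (IH q) => // w wzs.
have [|w0 rw] := H w _; first by rewrite inE wzs orbT.
split=> //; move: rw; rewrite fE rootM root_XsubC => /orP[//|/eqP wz].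
by rewrite -wz wzs in zzs.
Qed.

End Descartes.

(** * Real polynomials with coefficients of size [B^(-i^2)] *)

Section Separated.
Variable R : rcfType.
Variables (n : nat) (B : R).
Hypotheses (B1 : 1 < B) (Bn : n%:R ^+ 3 < B).
Implicit Types (sg : nat -> option bool) (w : R) (i j k l : nat).

Let B0 : 0 < B. Proof. exact: lt_trans B1. Qed.

Definition sep_coef sg i : R :=
  match sg i with
  | None => 0
  | Some s => (if s then 1 else -1) / B ^+ (i ^ 2)
  end.

Definition sep_poly sg : {poly R} := \poly_(i < n) sep_coef sg i.

Definition sep_term w i : R := w ^+ i / B ^+ (i ^ 2).

Lemma sep_term_add w i d :
  sep_term w (i + d) = sep_term w i * (w / B ^+ (i + (i + d))) ^+ d.
Proof.
rewrite /sep_term expr_div_n -exprM.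
have -> : ((i + d) ^ 2 = i ^ 2 + (i + (i + d)) * d)%N by rewrite !expnS !expn0; lia.
by rewrite !exprD invfM mulrACA.
Qed.

Lemma sep_term_gt0 w i : 0 < w -> 0 < sep_term w i.
Proof. by move=> w0; rewrite divr_gt0 ?exprn_gt0. Qed.

(** By [sep_term_add] the ratio of the terms is the power [j - i] of [w / B^(i+j)], so they compare
    as [w] and [B^(i+j)] do. A margin [B] survives because the power is at least 1. *)
Lemma sep_lt w i j : (i < j)%N -> 0 < w ->
  [/\ B ^+ (i + j) * B <= w -> B * sep_term w i <= sep_term w j,
      w * B <= B ^+ (i + j) -> B * sep_term w j <= sep_term w i,
      sep_term w i <= sep_term w j -> B ^+ (i + j) <= w &
      sep_term w j <= sep_term w i -> w <= B ^+ (i + j)].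
Proof.
move=> ij w0; rewrite -(subnKC (ltnW ij)); set d := (j - i)%N.
have d0 : (0 < d)%N by rewrite subn_gt0.
rewrite sep_term_add; set Bd := B ^+ _; set q := w / Bd.
have Bd0 : 0 < Bd by rewrite exprn_gt0.
have q0 : 0 < q by rewrite divr_gt0.
have Ti0 := sep_term_gt0 i w0; have B1' := ltW B1.
have wE : w = q * Bd by rewrite /q divfK // gt_eqF.
move: (sep_term w i) Ti0 => T Ti0; rewrite wE; clearbody q; split.
- rewrite mulrC ler_pM2r // => Bq; rewrite mulrC ler_pM2l //.
  by apply: (le_trans Bq); apply: ler_eXnr => //; exact: le_trans Bq.
- rewrite mulrAC -{2}(mul1r Bd) ler_pM2r // => qB.
  have q1 : q <= 1 by apply: le_trans (qB); rewrite ler_peMr // ltW.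
  rewrite mulrCA -{2}(mulr1 T) ler_pM2l // mulrC.
  apply: le_trans qB; rewrite ler_pM2r //; apply: ler_iXnr => //; exact: ltW.
- rewrite -{1}(mulr1 T) ler_pM2l // => q1.
  rewrite -{1}(mul1r Bd) ler_pM2r // leNgt; apply/negP => ql1.
  by move: q1; rewrite leNgt exprn_ilt1 ?ltW // -lt0n d0.
- rewrite -{2}(mulr1 T) ler_pM2l // => q1.
  rewrite -{2}(mul1r Bd) ler_pM2r // leNgt; apply/negP => ql1.
  by move: q1; rewrite leNgt exprn_egt1 // -lt0n d0.
Qed.

Lemma sep_pow i j : (B ^+ i <= B ^+ j) = (i <= j)%N.
Proof. by rewrite ler_eXn2l. Qed.

(** A least term with the middle index would put [w] both above and below two powers of [B] in the
    wrong order. If [i] is an outer index, [w] lies beyond one balance point, hence beyond the next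
    one by a factor [B]. *)
Lemma sep_third w i k l : 0 < w -> i != k -> i != l -> k != l ->
  sep_term w l <= sep_term w k -> sep_term w i <= sep_term w l ->
  B * sep_term w i <= sep_term w k.
Proof.
move=> w0 ik il kl Hlk Hil.
have pw a b : (B ^+ a <= w) -> (w <= B ^+ b) -> (a <= b)%N.
  by move=> h1 h2; rewrite -sep_pow; exact: le_trans h2.
case: (ltngtP i k) ik => // ik _; case: (ltngtP i l) il => // il _;
  case: (ltngtP k l) kl => // kl _.
- have [H1 _ H3 _] := sep_lt ik w0; have [_ _ H3' _] := sep_lt il w0.
  apply: H1; apply: le_trans (H3' Hil); rewrite -exprSr sep_pow; lia.
- have [H1 _ _ _] := sep_lt il w0; have [_ _ H3 _] := sep_lt kl w0.
  apply: le_trans (Hlk); apply: H1; apply: le_trans (H3 Hlk); rewrite -exprSr sep_pow; lia.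
- exfalso; lia.
- have [_ _ H3 _] := sep_lt kl w0; have [_ _ _ H4] := sep_lt il w0.
  by have := pw _ _ (H3 Hlk) (H4 Hil); lia.
- have [_ _ _ H4] := sep_lt kl w0; have [_ _ H3 _] := sep_lt il w0.
  by have := pw _ _ (H3 Hil) (H4 Hlk); lia.
- exfalso; lia.
- have [_ H2 _ _] := sep_lt il w0; have [_ _ _ H4] := sep_lt kl w0.
  apply: le_trans (Hlk); apply: H2.
  apply: le_trans (_ : B ^+ (k + l) * B <= _); first by rewrite ler_pM2r // H4.
  rewrite -exprSr sep_pow; lia.
- have [_ H2 _ _] := sep_lt ik w0; have [_ _ _ H4] := sep_lt il w0.
  apply: H2; apply: le_trans (_ : B ^+ (l + i) * B <= _); first by rewrite ler_pM2r // H4.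
  rewrite -exprSr sep_pow; lia.
Qed.

Lemma sep_at_vertex i k : i != k ->
  B * sep_term (B ^+ (k + k)) i <= sep_term (B ^+ (k + k)) k.
Proof.
move=> ik; have w0 : 0 < B ^+ (k + k) by rewrite exprn_gt0.
case: (ltngtP i k) ik => // ik _.
- have [H _ _ _] := sep_lt ik w0; apply: H; rewrite -exprSr sep_pow; lia.
- have [_ H _ _] := sep_lt ik w0; apply: H; rewrite -exprSr sep_pow; lia.
Qed.

Lemma sep_coef_norm sg w i : 0 <= w ->
  `|sep_coef sg i * w ^+ i| = if sg i is None then 0 else sep_term w i.
Proof.
move=> w0; rewrite /sep_coef; case: (sg i) => [s|]; last by rewrite mul0r normr0.
rewrite /sep_term mulrAC normrM normrM (ger0_norm (_ : 0 <= (B ^+ _)^-1)); last first.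
  by rewrite invr_ge0 exprn_ge0 // ltW.
rewrite (ger0_norm (exprn_ge0 i w0)).
by case: s; rewrite ?normrN normr1 mul1r.
Qed.

(** At [B^(2k)] every other term is smaller than the term [k] by a factor [B], and there are at most
    [n <= n^3 < B] of them. *)
Lemma sep_sign_at_vertex sg k s : (k < n)%N -> sg k = Some s ->
  if s then 0 < (sep_poly sg).[B ^+ (k + k)] else (sep_poly sg).[B ^+ (k + k)] < 0.
Proof.
move=> kn ks; set w := B ^+ (k + k); have w0 : 0 < w by rewrite exprn_gt0.
rewrite horner_poly (bigD1 (Ordinal kn)) //=; set rest := \sum_(_ < _ | _) _.
have Tk0 := sep_term_gt0 k w0.
have Hrest : `|rest| < sep_term w k.
  apply: le_lt_trans (ler_norm_sum _ _ _) _.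
  rewrite -(ltr_pM2l B0) mulr_sumr.
  apply: (@le_lt_trans _ _ (\sum_(i < n) sep_term w k)).
    rewrite big_mkcond; apply: ler_sum => i _; case: eqP => /= ik; first exact: ltW.
    rewrite sep_coef_norm; last exact: ltW.
    case: (sg i) => [_|]; last by rewrite mulr0 ltW.
    by apply: sep_at_vertex; apply/eqP => ik'; apply: ik; apply: val_inj.
  rewrite sumr_const card_ord -mulr_natl ltr_pM2r //.
  apply: le_lt_trans Bn; case: (n) => [|m]; first by rewrite expr0n.
  by apply: ler_eXnr => //; rewrite ler1n.
rewrite {1 2}/sep_coef ks.
move: Hrest; rewrite ltr_norml /sep_term => /andP[].
by case: (s); rewrite ?mul1r ?mulN1r ?mulNr [_^-1 * _]mulrC; lra.
Qed.

(** Intermediate values between [B^(2k)] and [B^(2m)] give a root at each change of sign; the lower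
    bound [B^(k+k)] carried along keeps the roots distinct. *)
Lemma sep_roots_after sg k s m N : (k < m)%N -> (m + N <= n)%N -> sg k = Some s ->
  exists zs, [/\ uniq zs, (forall z, z \in zs -> B ^+ (k + k) < z /\ root (sep_poly sg) z) &
    size zs = sign_changes (Some s) [seq sg i | i <- iota m N]].
Proof.
elim: N m k s => [|N IH] m k s km mN ks; first by exists [::].
rewrite -[[seq sg i | i <- iota m N.+1]]/(sg m :: [seq sg i | i <- iota m.+1 N]).
rewrite addnS -addSn in mN.
case ms : (sg m) => [t|] /=; last by apply: IH => //; exact: leqW.
have [zs [uzs Hzs szs]] := IH _ _ _ (ltnSn m) mN ms; rewrite -szs.
have Bkm : B ^+ (k + k) < B ^+ (m + m) by rewrite ltr_eXn2l //; lia.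
have [st|st] := eqVneq (Some s) (Some (~~ t)); last first.
  by exists zs; split => // z /Hzs [Bz rz]; split => //; exact: lt_trans Bz.
case: st => st.
have kn : (k < n)%N by apply: leq_trans mN; rewrite ltnS (leq_trans (ltnW km)) ?leq_addr.
have mn : (m < n)%N by apply: leq_trans mN; rewrite ltnS leq_addr.
have Hk := sep_sign_at_vertex kn ks; have Hm := sep_sign_at_vertex mn ms.
have [|z zkm rz] := @poly_ivtoo _ (sep_poly sg) _ _ (ltW Bkm).
  by move: Hk Hm; rewrite st; case: (t) => /= h1 h2; nra.
move: zkm; rewrite in_itv /= => /andP[kz zm].
exists (z :: zs); split => /=; last by rewrite add1n.
  by rewrite uzs andbT; apply/negP => /Hzs [/(lt_trans zm)]; rewrite ltxx.
move=> x; rewrite inE => /orP[/eqP -> //|/Hzs [xm rx]]; split => //.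
exact: lt_trans xm.
Qed.

Lemma sep_positive_roots sg :
  exists zs, [/\ uniq zs, (forall z, z \in zs -> 0 < z /\ root (sep_poly sg) z) &
    size zs = sign_changes None [seq sg i | i <- iota 0 n]].
Proof.
suff H N m : (m + N <= n)%N -> exists zs,
    [/\ uniq zs, (forall z, z \in zs -> 0 < z /\ root (sep_poly sg) z) &
    size zs = sign_changes None [seq sg i | i <- iota m N]] by exact: H.
elim: N m => [|N IH] m mN; first by exists [::].
rewrite -[[seq sg i | i <- iota m N.+1]]/(sg m :: [seq sg i | i <- iota m.+1 N]).
rewrite addnS -addSn in mN.
case ms : (sg m) => [t|] /=; last exact: IH.
have [zs [uzs Hzs szs]] := sep_roots_after (ltnSn m) mN ms; rewrite -szs.
exists zs; split => // z /Hzs [Bz rz]; split => //.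
by apply: lt_trans Bz; rewrite exprn_gt0.
Qed.

Local Notation C := R[i].
Local Notation toC := (real_complex R).
Local Notation nrm := (@Normc.normc R).

Lemma nrm_real (x : R) : nrm (toC x) = `|x|.
Proof. by rewrite /= expr0n addr0 sqrtr_sqr. Qed.

Lemma nrmX (z : C) j : nrm (z ^+ j) = nrm z ^+ j.
Proof.
by elim: j => [|j IH]; rewrite ?exprS ?Normc.normcM ?IH // Normc.normc1.
Qed.

Lemma nrm_sum (I : Type) (r : seq I) (P : pred I) (E : I -> C) :
  nrm (\sum_(i <- r | P i) E i) <= \sum_(i <- r | P i) nrm (E i).
Proof.
elim/big_rec2: _ => [|i y1 y2 _ H]; first by rewrite Normc.normc0.
by apply: le_trans (le_normcD _ _) _; rewrite lerD2l.
Qed.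

Lemma nrm_add_eq0 (x y : C) : x + y = 0 -> nrm x = nrm y.
Proof. by move/eqP; rewrite addr_eq0 => /eqP ->; rewrite normcN. Qed.

(** The Euler operator only weights the terms of [p] by their index, so [p] and its derivative can
    be compared term by term. *)
Lemma deriv_horner_mul (A : comNzRingType) (p : {poly A}) N z : (size p <= N)%N ->
  p^`().[z] * z = \sum_(i < N) i%:R * (p`_i * z ^+ i).
Proof.
move=> pN.
have {1}-> : p = \sum_(i < N) p`_i *: 'X^i.
  rewrite -poly_def; apply/polyP => i; rewrite coef_poly; case: ltnP => // Ni.
  by rewrite nth_default // (leq_trans pN).
rewrite raddf_sum /= horner_sum mulr_suml; apply: eq_bigr => i _.
rewrite derivZ derivXn hornerZ hornerMn hornerXn.
case: (nat_of_ord i) => [|j]; first by rewrite mulr0n mulr0 !mul0r.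
by rewrite /= exprSr -mulr_natl; ring.
Qed.

(** At a double root the sum of the terms and their sum weighted by the index both vanish.
    Subtracting [k] times the former removes the largest term [k]; the second largest, [l], is then
    left to be balanced by terms that [sep_third] makes too small. *)
Lemma sep_simple_root sg (z : C) : (exists2 i, (i < n)%N & sg i <> None) -> z != 0 ->
  root (map_poly toC (sep_poly sg)) z -> ~~ root (map_poly toC (sep_poly sg))^`() z.
Proof.
move=> [i0 i0n si0] z0 rz; apply/negP => rz'.
pose w : R := nrm z; have w0 : 0 < w.
  rewrite lt_neqAle eq_sym (_ : 0 <= w) ?andbT; last first.
    by rewrite /w; case: (z) => a b /=; rewrite sqrtr_ge0.
  by apply: contra z0 => /eqP /Normc.eq0_normc ->.
set F := map_poly toC (sep_poly sg) in rz rz'.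
pose t i := if sg i is None then 0 else sep_term w i.
have t_ge0 i : 0 <= t i by rewrite /t; case: (sg i) => // _; exact/ltW/sep_term_gt0.
have sF : (size F <= n)%N by rewrite size_map_poly size_poly.
have Fn i : nrm (F`_i * z ^+ i) = if (i < n)%N then t i else 0.
  rewrite coef_map coef_poly Normc.normcM nrmX nrm_real; case: ifP => _; last by rewrite normr0 mul0r.
  rewrite /t -(sep_coef_norm sg i (ltW w0)) normrM (ger0_norm (exprn_ge0 i (ltW w0))) //.
have F0 : \sum_(i < n) F`_i * z ^+ i = 0.
  by move/rootP: rz; rewrite (horner_coef_wide _ sF).
have F1 : \sum_(i < n) i%:R * (F`_i * z ^+ i) = 0.
  by rewrite -deriv_horner_mul // (rootP rz') mul0r.
have [k _ Hk] := @arg_maxP _ _ _ (Ordinal i0n) xpredT (fun i : 'I_n => t i) isT.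
have tk0 : 0 < t k.
  apply: lt_le_trans (Hk (Ordinal i0n) isT); rewrite /t /=.
  by case: (sg i0) si0 => // _ _; exact: sep_term_gt0.
have tk : t k <= \sum_(i < n | i != k) t i.
  move: F0; rewrite (bigD1 k) //= => /nrm_add_eq0; rewrite Fn ltn_ord => ->.
  apply: le_trans (nrm_sum _ _ _) _; apply: ler_sum => i _.
  by rewrite Fn ltn_ord.
have [j0 j0k tj0] : exists2 j : 'I_n, j != k & 0 < t j.
  apply: contrapT => H; move: tk; rewrite big1 ?leNgt ?tk0 // => j jk.
  by apply/eqP; rewrite eq_le t_ge0 andbT leNgt; apply/negP => tj; apply: H; exists j.
have [l lk Hl] := @arg_maxP _ _ _ j0 (fun i : 'I_n => i != k) (fun i : 'I_n => t i) j0k.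
have tl0 : 0 < t l by apply: lt_le_trans tj0 (Hl _ j0k).
have n_gt0 : 0 < n%:R :> R by rewrite ltr0n (leq_ltn_trans _ i0n).
have tkl : t k <= n%:R * t l.
  apply: le_trans tk _; apply: le_trans (_ : \sum_(i < n) t l <= _).
    by rewrite [leLHS]big_mkcond; apply: ler_sum => i _; case: ifP => // /Hl.
  by rewrite sumr_const card_ord mulr_natl.
have t_fin (i : 'I_n) : 0 < t i -> t i = sep_term w i.
  by rewrite /t; case: (sg i) => //; rewrite ltxx.
have ti (i : 'I_n) : i != k -> i != l -> B * t i <= n%:R * t l.
  move=> ik il; have := t_ge0 i; rewrite le_eqVlt => /orP[/eqP <-|ti0].
    by rewrite mulr0 mulr_ge0 // ltW.
  apply: le_trans tkl; have := Hl _ ik; have := Hk l isT => /=.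
  rewrite (t_fin i) // (t_fin l) // (t_fin k) // => h1 h2.
  by apply: (@sep_third w i k l) => //; rewrite ?(inj_eq val_inj) // eq_sym.
have : (l%:R - k%:R) * (F`_l * z ^+ l) +
    \sum_(i < n | (i != k) && (i != l)) (i%:R - k%:R) * (F`_i * z ^+ i) = 0.
  transitivity (\sum_(i < n) (i%:R - k%:R) * (F`_i * z ^+ i)).
    by rewrite [RHS](bigD1 k) //= subrr mul0r add0r [RHS](bigD1 l) //=.
  under eq_bigr do rewrite mulrBl.
  by rewrite sumrB F1 -mulr_sumr F0 mulr0 subr0.
move/nrm_add_eq0.
have nat_sub (i j : 'I_n) : nrm (i%:R - j%:R : C) = `|i%:R - j%:R|.
  by rewrite -nrm_real rmorphB !rmorph_nat.
rewrite Normc.normcM nat_sub Fn ltn_ord.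
move=> E.
have lk1 : 1 <= `|l%:R - k%:R : R|.
  have : (l != k :> nat) by [].
  case: (ltngtP l k) => // h _.
    by rewrite distrC ger0_norm -?natrB ?ler0n ?ler1n ?subn_gt0 // ltnW.
  by rewrite ger0_norm -?natrB ?ler0n ?ler1n ?subn_gt0 // ltnW.
have dn (i : 'I_n) : `|i%:R - k%:R : R| <= n%:R.
  have [ik|ik] := leqP i k.
    by rewrite distrC -natrB // normr_nat ler_nat (leq_trans (leq_subr _ _)) // ltnW.
  by rewrite -natrB ?normr_nat ?ler_nat ?(leq_trans (leq_subr _ _)) // ltnW.
(* The origin of the cube: one factor [n] bounds the weights, one the number of terms, and one comes
   from [t k <= n * t l]. *)
have : B * t l <= n%:R ^+ 3 * t l.
  apply: (@le_trans _ _ (B * (`|l%:R - k%:R| * t l))).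
    by rewrite ler_pM2l // ler_peMl.
  rewrite E; apply: (@le_trans _ _ (B * \sum_(i < n | (i != k) && (i != l)) n%:R * t i)).
    rewrite ler_pM2l //; apply: le_trans (nrm_sum _ _ _) _; apply: ler_sum => i _.
    by rewrite Normc.normcM nat_sub Fn ltn_ord ler_wpM2r.
  rewrite mulr_sumr; apply: (@le_trans _ _ (\sum_(i < n) n%:R * (n%:R * t l))).
    rewrite [leLHS]big_mkcond; apply: ler_sum => i _; case: ifP => [/andP[ik il]|_].
      by rewrite mulrCA ler_pM2l // ti.
    by rewrite !mulr_ge0 // ltW.
  by rewrite sumr_const card_ord -mulr_natl le_eqVlt; apply/orP; left; apply/eqP; ring.
by rewrite ler_pM2r // leNgt Bn.
Qed.

End Separated.

(** * Complex roots of the initial form of an edge *)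

Section EdgeRoots.
Variable R : rcfType.
Variables (n : nat) (B : R).
Hypotheses (B1 : 1 < B) (Bn : n%:R ^+ 3 < B).
Implicit Types (sg : nat -> option bool).
Local Notation C := R[i].
Local Notation toC := (real_complex R).

Definition sign_twist sg k := if odd k then omap negb (sg k) else sg k.

Lemma sep_coef_sign sg k : sign_of (sep_coef B sg k) = sg k.
Proof.
have Bk : 0 < (B ^+ (k ^ 2))^-1 by rewrite invr_gt0 exprn_gt0 // (lt_trans ltr01).
rewrite /sign_of /sep_coef; case: (sg k) => [[]|]; last by rewrite eqxx.
  by rewrite mul1r gt_eqF Bk.
by rewrite mulN1r oppr_eq0 gt_eqF // oppr_gt0 lt_gtF.
Qed.

Lemma sep_coef_twist sg k : sep_coef B (sign_twist sg) k = (-1) ^+ k * sep_coef B sg k.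
Proof.
rewrite /sep_coef /sign_twist -signr_odd; case: (odd k); case: (sg k) => [[]|] /=;
by rewrite ?expr1 ?expr0 ?mulr0 ?mul1r ?mulN1r ?opprK.
Qed.

Lemma sep_poly_twist sg x : (sep_poly n B (sign_twist sg)).[x] = (sep_poly n B sg).[- x].
Proof.
rewrite !horner_poly; apply: eq_bigr => i _.
by rewrite sep_coef_twist (exprNn x) mulrCA mulrA.
Qed.

(** The sign [e] is 1 for positive and -1 for negative roots. Descartes' rule bounds the count from
    above, the roots given by intermediate values bound it from below. *)
Lemma count_real_roots sg sg' (e : R) (rs : seq C) :
  (exists2 k, (k < n)%N & sg' k <> None) -> e * e = 1 ->
  (forall x, root (sep_poly n B sg') x = root (sep_poly n B sg) (e * x)) ->
  uniq rs ->
  (forall z, z != 0 -> root (map_poly toC (sep_poly n B sg)) z = (z \in rs)) ->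
  count (fun z => (complex.Im z == 0) && (0 < e * complex.Re z)) rs =
  sign_changes None [seq sg' k | k <- iota 0 n].
Proof.
move=> [k0 k0n sk0] ee He urs Hrs; apply/eqP; rewrite eqn_leq; apply/andP; split.
- have -> : [seq sg' k | k <- iota 0 n] = [seq sign_of (sep_poly n B sg')`_k | k <- iota 0 n].
    apply/eq_in_map => k; rewrite mem_iota => /andP[_ kn].
    by rewrite coef_poly kn sep_coef_sign.
  rewrite -size_filter; set s := filter _ _.
  rewrite -(size_map (fun z => e * complex.Re z)); apply: descartes.
  + apply: contra_not_neq sk0 => f0; rewrite -sep_coef_sign.
    have := coef_poly n (sep_coef B sg') k0; rewrite k0n -/(sep_poly n B sg').
    by rewrite f0 coef0 => <-; rewrite /sign_of eqxx.
  + exact: size_poly.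
  + rewrite map_inj_in_uniq ?filter_uniq // => x y.
    rewrite !mem_filter => /andP[/andP[/eqP x0 _] _] /andP[/andP[/eqP y0 _] _] /(congr1 (fun u => e * u)).
    rewrite !mulrA ee !mul1r; case: x y x0 y0 => a b [c d] /= -> -> -> //.
  + move=> z /mapP[x]; rewrite mem_filter => /andP[/andP[/eqP x0 xp] xrs] ->.
    split=> //; rewrite He mulrA ee mul1r.
    have xE : x = toC (complex.Re x) by case: (x) x0 => a b /= ->.
    have xn0 : x != 0.
      apply: contraTneq xp => ->; by rewrite /= mulr0 ltxx.
    have : root (map_poly toC (sep_poly n B sg)) x by rewrite Hrs.
    by rewrite xE fmorph_root.
- have [zs [uzs Hzs <-]] := sep_positive_roots B1 Bn sg'.
  rewrite -size_filter -(size_map (fun z => toC (e * z))).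
  apply: uniq_leq_size.
    rewrite map_inj_uniq // => x y /complexI /(congr1 (fun u => e * u)).
    by rewrite !mulrA ee !mul1r.
  move=> z /mapP[x /Hzs [x0 rx] ->]; rewrite mem_filter /= eqxx mulrA ee mul1r x0 /=.
  rewrite -Hrs; first by rewrite fmorph_root -He.
  rewrite fmorph_eq0; apply/negP => ex0.
  have e0 : e = 0 by move: ex0; rewrite mulf_eq0 (gt_eqF x0) orbF => /eqP.
  by move/eqP: ee; rewrite e0 mulr0 eq_sym oner_eq0.
Qed.

(** Removing [X^i] leaves a polynomial of degree [j - i] with nonzero constant term, whose complex
    roots are distinct because the nonzero roots of [F] are simple. *)
Lemma sep_edge_roots sg i j : (i < j)%N -> (j < n)%N ->
  sg i <> None -> sg j <> None ->
  (forall k, sg k <> None -> (i <= k <= j)%N) ->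
  exists rs : seq C, [/\ uniq rs, size rs = (j - i)%N,
    (forall z, z \in rs -> [/\ z != 0, root (map_poly toC (sep_poly n B sg)) z &
       ~~ root (map_poly toC (sep_poly n B sg))^`() z]),
    count (fun z => (complex.Im z == 0) && (0 < complex.Re z)) rs =
      sign_changes None [seq sg k | k <- iota 0 n] &
    count (fun z => (complex.Im z == 0) && (complex.Re z < 0)) rs =
      sign_changes None [seq sign_twist sg k | k <- iota 0 n]].
Proof.
move=> ij jn si sj sij; set F := map_poly toC (sep_poly n B sg).
have i_n := ltn_trans ij jn.
have Fc k : F`_k = if (k < n)%N then toC (sep_coef B sg k) else 0.
  by rewrite coef_map coef_poly; case: ifP => // _; rewrite rmorph0.
have Fc0 k : (k < n)%N -> sg k <> None -> F`_k != 0.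
  move=> kn sk; rewrite Fc kn fmorph_eq0; apply: contra_not_neq sk => c0.
  by rewrite -(sep_coef_sign sg k) c0 /sign_of eqxx.
have FcN k : ~~ (i <= k <= j)%N -> F`_k = 0.
  move=> kij; rewrite Fc; case: ifP => // _; rewrite /sep_coef.
  case sk : (sg k) => [s|]; last by rewrite rmorph0.
  by rewrite sij ?sk in kij.
pose Q := drop_poly i F.
have FQ : F = Q * 'X^i.
  rewrite -[LHS](poly_take_drop i) -[RHS]add0r; congr (_ + _).
  apply/polyP => k; rewrite coef_take_poly coef0; case: ltnP => // ki.
  by rewrite FcN // leqNgt ki.
have sF : size F = j.+1.
  apply/eqP; rewrite eqn_leq; apply/andP; split.
    by apply/leq_sizeP => k jk; rewrite FcN // negb_and -!ltnNge jk orbT.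
  rewrite ltnNge; apply/negP => /leq_sizeP /(_ j (leqnn _)) /eqP.
  by rewrite (negbTE (Fc0 _ jn sj)).
have sQ : size Q = (j - i).+1 by rewrite size_drop_poly sF subSn // ltnW.
have Q0 : ~~ root Q 0.
  by rewrite rootE horner_coef0 coef_drop_poly add0n Fc0.
have rFQ z : z != 0 -> root F z = root Q z.
  by move=> z0; rewrite FQ rootM /root hornerXn expf_eq0 (negbTE z0) andbF orbF.
have Fsimple z : z != 0 -> root F z -> ~~ root F^`() z.
  by apply: (sep_simple_root B1 Bn); exists i.
have [rs QE] := closed_field_poly_normal Q.
have lQ : lead_coef Q != 0 by rewrite lead_coef_eq0 -size_poly_eq0 sQ.
have rQ z : root Q z = (z \in rs) by rewrite QE rootZ // root_prod_XsubC.
have rs0 z : z \in rs -> z != 0 by rewrite -rQ => rz; apply: contraNneq Q0 => <-.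
have urs : uniq rs.
  rewrite -separable_prod_XsubC unlock; apply: Pdiv.ClosedField.root_coprimep => z.
  rewrite root_prod_XsubC => zrs; have z0 := rs0 z zrs.
  have Fz : root F z by rewrite rFQ // rQ.
  apply: contra (Fsimple z z0 Fz) => /eqP Gz; rewrite FQ derivM rootE hornerD !hornerM.
  move: zrs; rewrite -rQ => /eqP ->; rewrite mul0r addr0 QE derivZ hornerZ.
  by rewrite Gz mulr0 mul0r.
have Hrs z : z != 0 -> root F z = (z \in rs) by move=> z0; rewrite rFQ // rQ.
exists rs; split => //.
- by apply/eqP; rewrite -eqSS -sQ QE size_scale // size_prod_XsubC.
- by move=> z zrs; have z0 := rs0 z zrs; have Fz : root F z by [rewrite Hrs]; split=> //; exact: Fsimple.
- rewrite -(@count_real_roots sg sg 1 rs) ?mulr1 //.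
  + by apply: eq_count => z; rewrite mul1r.
  + by exists i.
  + by move=> x; rewrite mul1r.
- rewrite -(@count_real_roots sg (sign_twist sg) (-1) rs) ?mulrN1 ?opprK //.
  + by apply: eq_count => z; rewrite mulN1r oppr_gt0.
  + by exists i => //; rewrite /sign_twist; case: odd => //; case: (sg i) si.
  + by move=> x; rewrite !rootE sep_poly_twist mulN1r.
Qed.

End EdgeRoots.

(** * Lower convex hulls *)

Section Hull.
Variables (R : realFieldType) (n : nat) (V : nat -> option R).
Hypothesis Vn : forall k, (n <= k)%N -> V k = None.
Implicit Types (i j k l : nat) (lam : R).

Definition hull_edge i j lam : Prop :=
  (i < j)%N /\
  exists vi vj, V i = Some vi /\ V j = Some vj /\
    lam = (vj - vi) / (j%:R - i%:R) /\
    (forall k vk, V k = Some vk ->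
        vi + (k%:R - i%:R) * lam <= vk /\
        (vk = vi + (k%:R - i%:R) * lam -> (i <= k <= j)%N)).

(** Trades the endpoints for the supporting line, whose intercept [mu] is the common height of the
    edge's terms once they are evaluated at valuation [- lam]. *)
Lemma hull_edge_line i j lam : hull_edge i j lam ->
  exists mu, [/\ V i = Some (mu + i%:R * lam), V j = Some (mu + j%:R * lam),
    (forall k vk, V k = Some vk -> mu + k%:R * lam <= vk) &
    (forall k, V k = Some (mu + k%:R * lam) -> (i <= k <= j)%N)].
Proof.
move=> [ij [vi [vj [Vi [Vj [lamE H]]]]]].
have ij0 : j%:R - i%:R != 0 :> R by rewrite subr_eq0 eqr_nat gtn_eqF.
have vjE : vj = vi + (j%:R - i%:R) * lam by rewrite lamE mulrC divfK //; ring.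
exists (vi - i%:R * lam); split.
- by rewrite subrK.
- by rewrite Vj vjE; congr Some; ring.
- by move=> k vk /H [h _]; apply: le_trans h; rewrite le_eqVlt; apply/orP; left; apply/eqP; ring.
- by move=> k /H [_]; apply; ring.
Qed.

Lemma hull_edge_uniq i j i' j' lam : hull_edge i j lam -> hull_edge i' j' lam ->
  i = i' /\ j = j'.
Proof.
move=> /hull_edge_line[mu [Vi Vj H1 H2]] /hull_edge_line[mu' [Vi' Vj' H1' H2']].
have mm : mu = mu'.
  apply/eqP; rewrite eq_le; have := H1 _ _ Vi'; have := H1' _ _ Vi.
  by rewrite !lerD2r => -> ->.
subst mu'.
have := H2 _ Vi'; have := H2 _ Vj'; have := H2' _ Vi; have := H2' _ Vj; lia.
Qed.

(** Moving the left endpoint of a chord to a point below its line lowers it at [x]; [chord_gt] does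
    the same on the right. *)
Lemma chord_lt (l x j vl vj lam : R) : l < x -> x < j -> vl < vj - (j - l) * lam ->
  vl + (x - l) * ((vj - vl) / (j - l)) < vj - (j - x) * lam.
Proof.
move=> lx xj H; have jl : 0 < j - l by lra.
have jl0 : j - l != 0 by rewrite gt_eqF.
have qE : (vj - vl) / (j - l) * (j - l) = vj - vl by rewrite divfK.
move: (_ / _) qE => q qE.
have lq : lam < q by rewrite -(ltr_pM2r jl) qE mulrC; lra.
have : (j - x) * lam < (j - x) * q by rewrite ltr_pM2l ?subr_gt0.
have -> : vl + (x - l) * q = vj - (j - x) * q by rewrite -(subrK vl vj) -qE; ring.
lra.
Qed.

Lemma chord_gt (l x j vl vj lam : R) : l < x -> x < j -> vj < vl + (j - l) * lam ->
  vl + (x - l) * ((vj - vl) / (j - l)) < vl + (x - l) * lam.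
Proof.
move=> lx xj H; have jl : 0 < j - l by lra.
rewrite ltrD2l ltr_pM2l ?subr_gt0 // ltr_pdivrMr // mulrC; lra.
Qed.

(* The chord that is lowest above [k + 1/2] lies on the hull. *)
Lemma hull_cover m k M : (m <= k < M)%N -> V m <> None -> V M <> None ->
  exists i j lam, (i <= k < j)%N /\ hull_edge i j lam.
Proof.
move=> /andP[mk kM] Vm VM.
have lt_n i : V i <> None -> (i < n)%N by move=> Vi; rewrite ltnNge; apply/negP => /Vn.
pose v i := odflt 0 (V i).
(* No index equals [k + 1/2], so every point lies strictly on one side and can be joined to the
   endpoint on the other. *)
pose x : R := k%:R + 2^-1.
have vE i : V i <> None -> V i = Some (v i) by rewrite /v; case: (V i).
have lx i : (i <= k)%N -> i%:R < x.
  by rewrite -(ler_nat R) /x => h; have : 0 < 2^-1 :> R by [rewrite invr_gt0 ltr0n]; lra.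
have xl j : (k < j)%N -> x < j%:R.
  rewrite -(ler_nat R) /x mulrSr => h; have : 2^-1 < 1 :> R by rewrite invf_lt1 ?ltr1n.
  by lra.
pose good (ij : 'I_n * 'I_n) := [&& V ij.1 != None, V ij.2 != None, (ij.1 <= k)%N & (k < ij.2)%N].
pose h (ij : 'I_n * 'I_n) : R := v ij.1 + (x - ij.1%:R) * ((v ij.2 - v ij.1) / (ij.2%:R - ij.1%:R)).
have g0 : good (Ordinal (lt_n _ Vm), Ordinal (lt_n _ VM)).
  by rewrite /good /= mk kM; case: (V m) Vm => // ? _; case: (V M) VM => //.
have [[i j] /= gij hmin] := @arg_minP _ _ _ _ good h g0.
have {gij} [Vi Vj ik kj] : [/\ V i <> None, V j <> None, (i <= k)%N & (k < j)%N].
  by move: gij => /and4P[/= /eqP ? /eqP ? ? ?].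
pose lam := (v j - v i) / (j%:R - i%:R).
have ij := leq_ltn_trans ik kj.
have ij0 : j%:R - i%:R != 0 :> R by rewrite subr_eq0 eqr_nat gtn_eqF.
pose mu := v i - i%:R * lam.
have vi : v i = mu + i%:R * lam by rewrite subrK.
have vj : v j = mu + j%:R * lam.
  have e : v j - v i = (j%:R - i%:R) * lam by rewrite /lam mulrC divfK.
  by rewrite -(subrK (v i) (v j)) e vi; ring.
have hE : h (i, j) = mu + x * lam by rewrite /h /= -/lam vi; ring.
(* A point below the line could replace the endpoint on its side and give a lower chord at [x]. *)
have above l : V l <> None -> mu + l%:R * lam <= v l.
  move=> Vl; rewrite leNgt; apply/negP => vl; have ln := lt_n l Vl.
  have [lk|kl] := leqP l k.
    have : h (i, j) <= h (Ordinal ln, j).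
      by apply: hmin; rewrite /good /= lk kj; case: (V l) Vl => // ? _; case: (V j) Vj => //.
    rewrite hE leNgt /h /=; case/negP.
    have := @chord_lt l%:R x j%:R (v l) (v j) lam (lx _ lk) (xl _ kj).
    have -> : v j - (j%:R - l%:R) * lam = mu + l%:R * lam by rewrite vj; ring.
    have -> : v j - (j%:R - x) * lam = mu + x * lam by rewrite vj; ring.
    exact.
  have : h (i, j) <= h (i, Ordinal ln).
    by apply: hmin; rewrite /good /= ik kl; case: (V l) Vl => // ? _; case: (V i) Vi => //.
  rewrite hE leNgt /h /=; case/negP.
  have := @chord_gt i%:R x l%:R (v i) (v l) lam (lx _ ik) (xl _ kl).
  have -> : v i + (l%:R - i%:R) * lam = mu + l%:R * lam by rewrite vi; ring.
  have -> : v i + (x - i%:R) * lam = mu + x * lam by rewrite vi; ring.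
  exact.
pose on l := V l == Some (mu + l%:R * lam).
have on_n l : on l -> (l <= n)%N.
  by move/eqP => e; apply/ltnW/lt_n; rewrite e.
have on_i : on i by rewrite /on vE // vi.
have on_j : on j by rewrite /on vE // vj.
have exon : exists l, on l by exists i.
(* The minimal chord may be only a piece of its edge, so its ends are moved to the extreme points on
   the line. *)
case: (ex_minnP exon) => i' oni' mini'; case: (ex_maxnP exon on_n) => j' onj' maxj'.
exists i', j', lam.
have i'i := mini' _ on_i; have jj' := maxj' _ on_j.
split; first by rewrite (leq_trans i'i) // (leq_trans kj).
have ij' : (i' < j')%N by apply: leq_trans jj'; exact: leq_ltn_trans ij.
split=> //; exists (mu + i'%:R * lam), (mu + j'%:R * lam); split; first exact/eqP.
split; first exact/eqP.
split.
  have e : mu + j'%:R * lam - (mu + i'%:R * lam) = lam * (j'%:R - i'%:R) by ring.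
  by rewrite e mulfK // subr_eq0 eqr_nat gtn_eqF.
move=> l vl Vl; have e : mu + i'%:R * lam + (l%:R - i'%:R) * lam = mu + l%:R * lam by ring.
rewrite e; split; first by have := above l; rewrite /v Vl; exact.
by move=> vlE; have onl : on l by [rewrite /on Vl vlE]; rewrite mini' // maxj'.
Qed.

End Hull.

(** * The ring of series with left-finite support *)

Section LeftFinite.
Variables (R : realType) (K : fieldType).
Implicit Types (a b c d m x M : R) (s : seq R).
Local Open Scope classical_set_scope.

(** Stronger than well-ordered support: finiteness below 0 bounds the support from below, so only
    finitely many pairs contribute to a coefficient of a product. *)
Definition left_finite (f : R -> K) : Prop :=
  forall M, finite_set [set a | f a != 0 /\ a <= M].

Record lfseries := LFSeries { lfval :> R -> K; lfvalP : left_finite lfval }.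

Lemma lfext (f g : lfseries) : (forall a, f a = g a) -> f = g.
Proof.
case: f g => [f Hf] [g Hg] /= fg; have fE : f = g by apply: funext.
by rewrite fE in Hf *; congr LFSeries; exact: Prop_irrelevance.
Qed.

Lemma left_finite_sub (f : R -> K) :
  (forall M, exists s, forall a, f a != 0 -> a <= M -> a \in s) -> left_finite f.
Proof.
move=> H M; have [s Hs] := H M; apply: (@sub_finite_set _ _ [set` s]).
  by move=> a [/= fa aM]; exact: Hs.
exact: finite_seq.
Qed.

Lemma lf_support (f : lfseries) M :
  exists2 s, uniq s & forall a, (a \in s) = (f a != 0) && (a <= M).
Proof.
exists (fset_set [set a | f a != 0 /\ a <= M]); first exact: fset_uniq.
move=> a; rewrite in_fset_set; last exact: lfvalP.
by apply/idP/andP => [/set_mem|H]; [|exact/mem_set].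
Qed.

Lemma seq_lb s : exists m, forall a, a \in s -> m <= a.
Proof.
elim: s => [|b s [m IH]]; first by exists 0.
exists (Num.min b m) => a; rewrite inE => /orP[/eqP ->|/IH ma].
  by rewrite ge_min lexx.
by rewrite ge_min ma orbT.
Qed.

Lemma lf_lb (f : lfseries) : exists m, forall a, f a != 0 -> m <= a.
Proof.
have [s _ Hs] := lf_support f 0; have [m Hm] := seq_lb s.
exists (Num.min m 0) => a fa; rewrite ge_min; case: (leP a 0) => [a0|/ltW ->].
  by rewrite Hm // Hs fa.
by rewrite orbT.
Qed.

(** Any duplicate-free list containing the contributing exponents computes the coefficient, so
    products can be compared over a common list. *)
Lemma hmulE (f g : R -> K) x s : uniq s ->
  (forall a, f a != 0 -> g (x - a) != 0 -> a \in s) ->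
  hmul f g x = \sum_(a <- s) f a * g (x - a).
Proof.
move=> us Hs.
pose t := [seq a <- s | (f a != 0) && (g (x - a) != 0)].
have -> : \sum_(a <- s) f a * g (x - a) = \sum_(ab <- [seq (a, x - a) | a <- t]) f ab.1 * g ab.2.
  rewrite big_map big_filter [RHS]big_mkcond /=; apply: eq_bigr => a _.
  by case: eqP => [->|_]; [rewrite mul0r|case: eqP => //= ->; rewrite mulr0].
rewrite fsbig_seq; last by rewrite map_inj_uniq ?filter_uniq // => a b [].
rewrite /hmul; apply: eq_fsbigl; apply/seteqP; split => -[a b] /=.
  move=> [fa [gb xE]]; have bE : x - a = b by rewrite -xE addrC addKr.
  apply/mapP; exists a; last by rewrite bE.
  by rewrite mem_filter fa bE gb Hs // bE.
move=> /mapP[c]; rewrite mem_filter => /andP[/andP[fc gc] _] [-> ->].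
by split=> //; split=> //; rewrite addrC subrK.
Qed.

Lemma hmulC (f g : R -> K) : hmul f g = hmul g f.
Proof.
apply: funext => x; rewrite /hmul.
rewrite [LHS](@reindex_fsbig _ _ _ _ _ (fun ab => (ab.2, ab.1))
  [set ab | g ab.1 != 0 /\ f ab.2 != 0 /\ ab.1 + ab.2 = x]) /=.
  by apply: eq_fsbigr => -[a b] _ /=; rewrite mulrC.
split=> [[a b] /= [ga [fb <-]]|[a b] [c d] _ _ /= [-> ->] //|[a b] /= [fa [gb <-]]].
  by rewrite addrC.
by exists (b, a) => //=; rewrite addrC.
Qed.

Lemma hmul_neq0 (f g : R -> K) x : hmul f g x != 0 ->
  exists a, f a != 0 /\ g (x - a) != 0.
Proof.
move=> H; apply: contrapT => nH; move/negP: H; apply; apply/eqP.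
rewrite (hmulE (s := [::])) ?big_nil // => a fa ga.
by exfalso; apply: nH; exists a.
Qed.

Lemma hmul_left_finite (f g : lfseries) : left_finite (hmul f g).
Proof.
apply: left_finite_sub => M.
have [mf Hf] := lf_lb f; have [mg Hg] := lf_lb g.
have [sf _ Hsf] := lf_support f (M - mg); have [sg _ Hsg] := lf_support g (M - mf).
exists [seq a + b | a <- sf, b <- sg] => x /hmul_neq0 [a [fa gxa]] xM.
apply/allpairsP; exists (a, x - a) => /=.
have := Hf _ fa; have := Hg _ gxa => h1 h2.
by rewrite Hsf Hsg fa gxa /=; split; [lra|lra|rewrite addrC subrK].
Qed.

Definition lfmul (f g : lfseries) := LFSeries (hmul_left_finite f g).

Lemma lfmulA : associative lfmul.
Proof.
move=> f g h; apply: lfext => x /=.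
have [mf Hf] := lf_lb f; have [mg Hg] := lf_lb g; have [mh Hh] := lf_lb h.
(* The exponents of [g] and [h] are at least [mg] and [mh], so this bound keeps every exponent of
   [f] that contributes at [x]; the next one does it for [g]. *)
have [sf usf Hsf] := lf_support f (x - mg - mh).
have [sg usg Hsg] := lf_support g (x - mf - mh).
pose s := undup [seq a + b | a <- sf, b <- sg].
have mem_s b c : f b != 0 -> g c != 0 -> h (x - b - c) != 0 -> b + c \in s.
  move=> fb gc hx; rewrite mem_undup; apply/allpairsP; exists (b, c) => /=.
  have := Hf _ fb; have := Hg _ gc; have := Hh _ hx => h1 h2 h3.
  by rewrite Hsf Hsg fb gc /=; split=> //; lra.
rewrite (@hmulE f _ x sf usf) => [|b fb /hmul_neq0 [c [gc hc]]]; last first.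
  by rewrite Hsf fb /=; have := Hg _ gc; have := Hh _ hc => h1 h2; lra.
rewrite (@hmulE (lfmul f g) _ x s (undup_uniq _)) => [|a /hmul_neq0 [b [fb gb]] ha]; last first.
  have := mem_s b (a - b) fb gb; have -> : x - b - (a - b) = x - a by ring.
  have -> : b + (a - b) = a by ring.
  exact.
transitivity (\sum_(a <- s) \sum_(b <- sf) f b * g (a - b) * h (x - a)); last first.
  apply: eq_big_seq => a _ /=.
  have [->|ha] := eqVneq (h (x - a)) 0; first by rewrite mulr0 big1 // => b _; rewrite mulr0.
  rewrite (@hmulE f g a sf usf) ?mulr_suml // => b fb gb.
  by rewrite Hsf fb /=; have := Hg _ gb; have := Hh _ ha => h1 h2; lra.
rewrite exchange_big /=; apply: eq_big_seq => b; rewrite Hsf => /andP[fb _].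
rewrite (@hmulE g h (x - b) [seq a - b | a <- s]).
- rewrite big_map mulr_sumr; apply: eq_bigr => a _.
  by rewrite -mulrA; congr (_ * (_ * h _)); ring.
- by rewrite map_inj_uniq ?undup_uniq // => a c /addIr.
- move=> c gc hc; apply/mapP; exists (b + c); first exact: mem_s.
  by rewrite addrC addKr.
Qed.

Lemma lfmulC : commutative lfmul.
Proof. by move=> f g; apply: lfext => x /=; rewrite hmulC. Qed.

Definition hmono (k : K) (v : R) : R -> K := fun x => if x == v then k else 0.

Lemma hmono_left_finite k v : left_finite (hmono k v).
Proof.
apply: left_finite_sub => M; exists [:: v] => a; rewrite /hmono inE.
by case: ifP => //; rewrite eqxx.
Qed.

Definition lfmono k v := LFSeries (hmono_left_finite k v).

Lemma hmul_mono k v (f : R -> K) x : hmul (hmono k v) f x = k * f (x - v).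
Proof.
rewrite (@hmulE _ _ x [:: v]) ?big_seq1 ?/hmono ?eqxx // => a.
by rewrite inE; case: ifP => //; rewrite eqxx.
Qed.

Lemma lfmul1 : left_id (lfmono 1 0) lfmul.
Proof. by move=> f; apply: lfext => x /=; rewrite hmul_mono mul1r subr0. Qed.

Lemma left_finite_add (f g : lfseries) : left_finite (fun x => f x + g x).
Proof.
apply: left_finite_sub => M.
have [sf _ Hsf] := lf_support f M; have [sg _ Hsg] := lf_support g M.
exists (sf ++ sg) => a fga aM; rewrite mem_cat Hsf Hsg aM !andbT.
by rewrite -negb_and; apply: contraNN fga => /andP[/eqP -> /eqP ->]; rewrite addr0.
Qed.

Lemma left_finite_opp (f : lfseries) : left_finite (fun x => - f x).
Proof.
by move=> M; have := lfvalP f M; congr finite_set; apply/seteqP; split => a /=; rewrite oppr_eq0.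
Qed.

Definition lfadd f g := LFSeries (left_finite_add f g).
Definition lfopp f := LFSeries (left_finite_opp f).

Lemma lfaddA : associative lfadd.
Proof. by move=> f g h; apply: lfext => x /=; rewrite addrA. Qed.
Lemma lfaddC : commutative lfadd.
Proof. by move=> f g; apply: lfext => x /=; rewrite addrC. Qed.
Lemma lfadd0 : left_id (lfmono 0 0) lfadd.
Proof. by move=> f; apply: lfext => x /=; rewrite /hmono if_same add0r. Qed.
Lemma lfaddN : left_inverse (lfmono 0 0) lfopp lfadd.
Proof. by move=> f; apply: lfext => x /=; rewrite /hmono if_same addNr. Qed.

Lemma lfmulDl : left_distributive lfmul lfadd.
Proof.
move=> f g h; apply: lfext => x /=; rewrite !(hmulC _ h).
have [mf Hf] := lf_lb f; have [mg Hg] := lf_lb g.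
have [s us Hs] := lf_support h (x - Num.min mf mg).
have hs (f' : R -> K) : (forall a, f' a != 0 -> mf <= a \/ mg <= a) ->
    hmul h f' x = \sum_(a <- s) h a * f' (x - a).
  move=> H; apply: hmulE => // a ha /H Ha; rewrite Hs ha /=.
  rewrite lerBrDr -lerBrDl ge_min; by case: Ha => ->; rewrite ?orbT.
rewrite !hs; first by rewrite -big_split /=; apply: eq_bigr => a _; rewrite mulrDr.
- by move=> a /Hg; right.
- by move=> a /Hf; left.
move=> a fg; case: (eqVneq (f a) 0) => [fa|/Hf]; last by left.
by right; apply: Hg; move: fg; rewrite fa add0r.
Qed.

Lemma lfmono1_neq0 : lfmono 1 0 <> lfmono 0 0.
Proof. by move=> /(congr1 (fun f : lfseries => f 0)) /=; rewrite /hmono eqxx => /eqP; rewrite oner_eq0. Qed.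

HB.instance Definition _ := gen_eqMixin lfseries.
HB.instance Definition _ := gen_choiceMixin lfseries.
HB.instance Definition _ := GRing.isZmodule.Build lfseries lfaddA lfaddC lfadd0 lfaddN.

Lemma lfone_neq0 : lfmono 1 0 != 0 :> lfseries.
Proof. by apply/eqP => /lfmono1_neq0. Qed.

HB.instance Definition _ := GRing.Zmodule_isComNzRing.Build lfseries
  lfmulA lfmulC lfmul1 lfmulDl lfone_neq0.

End LeftFinite.

(** * Hensel's lemma *)

Section Hensel.
Variables (R : realType) (K : fieldType).
Local Notation L := (lfseries R K).
Implicit Types (f g h : L) (a d e m : R) (k : K) (F : {poly L}).

Lemma lfDE f g x : (f + g) x = f x + g x. Proof. by []. Qed.
Lemma lfNE f x : (- f) x = - f x. Proof. by []. Qed.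
Lemma lfME f g x : (f * g) x = hmul f g x. Proof. by []. Qed.
Lemma lf0E x : (0 : L) x = 0. Proof. by rewrite /= /hmono if_same. Qed.

(** A lower bound for the valuation instead of the valuation itself, so that the zero series is no
    special case. *)
Definition vge m f : Prop := forall d, d < m -> f d = 0.

Lemma vge0 m : vge m 0. Proof. by move=> d _; rewrite lf0E. Qed.

Lemma vgeD m f g : vge m f -> vge m g -> vge m (f + g).
Proof. by move=> Hf Hg d dm; rewrite lfDE Hf ?Hg ?addr0. Qed.

Lemma vgeN m f : vge m f -> vge m (- f).
Proof. by move=> Hf d dm; rewrite lfNE Hf ?oppr0. Qed.

Lemma vgeB m f g : vge m f -> vge m g -> vge m (f - g).
Proof. by move=> Hf Hg; apply: vgeD => //; exact: vgeN. Qed.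

Lemma vge_le m m' f : m' <= m -> vge m f -> vge m' f.
Proof. by move=> mm Hf d dm; apply: Hf; exact: lt_le_trans mm. Qed.

Lemma vgeP m f : vge m f <-> forall d, f d != 0 -> m <= d.
Proof.
split=> H d; first by move=> fd; rewrite leNgt; apply: contraNN fd => /H ->.
by move=> dm; apply/eqP; apply: contraLR dm => /H; rewrite -leNgt.
Qed.

Lemma vgeM m m' f g : vge m f -> vge m' g -> vge (m + m') (f * g).
Proof.
move=> /vgeP Hf /vgeP Hg; apply/vgeP => d /hmul_neq0 [a [/Hf fa /Hg ga]]; lra.
Qed.

Lemma vgeMl m f g : vge m f -> vge 0 g -> vge m (f * g).
Proof. by move=> Hf Hg; rewrite -(addr0 m); exact: vgeM. Qed.

Lemma vgeMr m f g : vge 0 f -> vge m g -> vge m (f * g).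
Proof. by move=> Hf Hg; rewrite mulrC; exact: vgeMl. Qed.

Lemma vge_mono m k v : m <= v -> vge m (lfmono k v).
Proof. by move=> mv d dm; rewrite /= /hmono lt_eqF // (lt_le_trans dm). Qed.

Lemma seq_min (s : seq R) b : b \in s -> exists2 a, a \in s & forall c, c \in s -> a <= c.
Proof.
elim: s b => // c t IH b _.
case: t IH => [|c' t] IH; first by exists c; rewrite ?mem_head // => x; rewrite inE => /eqP ->.
have [a at_ ale] := IH c' (mem_head _ _).
case: (leP a c) => ac.
  by exists a; rewrite 1?in_cons 1?at_ ?orbT // => x; rewrite in_cons => /orP[/eqP ->|/ale].
exists c; rewrite ?mem_head // => x; rewrite in_cons => /orP[/eqP ->//|/ale].
exact/le_trans/ltW.
Qed.

Lemma lf_mul_eq0 f g : f * g = 0 -> f = 0 \/ g = 0.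
Proof.
have lead (h : L) : h <> 0 -> exists2 a, h a != 0 & vge a h.
  move=> h0; have [b hb] : exists b, h b != 0.
    apply: contrapT => nb; apply: h0; apply: lfext => x; rewrite lf0E.
    by apply/eqP; apply: contrapT => hx; apply: nb; exists x; apply/negP.
  have [s _ Hs] := lf_support h b.
  have bs : b \in s by rewrite Hs hb lexx.
  have [a as_ ale] := seq_min bs.
  exists a; first by move: as_; rewrite Hs => /andP[].
  apply/vgeP => c hc; case: (leP c b) => cb; first by apply: ale; rewrite Hs hc cb.
  by apply: le_trans (ale _ bs) (ltW cb).
move=> fg; apply: contrapT => /not_orP [/lead [a fa Ha] /lead [b gb Hb]].
have : (f * g) (a + b) = 0 by rewrite fg lf0E.
rewrite lfME (@hmulE _ _ _ _ _ [:: a]) //.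
  rewrite big_seq1 addrAC subrr add0r => /eqP; rewrite mulf_eq0.
  by rewrite (negbTE fa) (negbTE gb).
move=> c fc gc; rewrite inE eq_le.
move/vgeP: Ha => /(_ _ fc) ->; move/vgeP: Hb => /(_ _ gc); rewrite andbT; lra.
Qed.

Definition lfconst k : L := lfmono k 0.

Lemma lfconst_zmod : zmod_morphism lfconst.
Proof. by move=> k l; apply: lfext => x; rewrite /= /hmono; case: ifP; rewrite ?subr0. Qed.

Lemma lfconst_monoid : monoid_morphism lfconst.
Proof.
split=> // k l; apply: lfext => x; rewrite lfME hmul_mono subr0 /= /hmono.
by case: ifP; rewrite ?mulr0.
Qed.

HB.instance Definition _ := GRing.isZmodMorphism.Build K L lfconst lfconst_zmod.
HB.instance Definition _ := GRing.isMonoidMorphism.Build K L lfconst lfconst_monoid.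

Lemma vge_const k : vge 0 (lfconst k). Proof. exact: vge_mono. Qed.

Lemma vge_sum m n (E : 'I_n -> L) : (forall i, vge m (E i)) -> vge m (\sum_(i < n) E i).
Proof. by move=> H; apply: (big_ind (vge m)) => //; [exact: vge0|move=> *; exact: vgeD]. Qed.

Lemma vgeX f n : vge 0 f -> vge 0 (f ^+ n).
Proof. by move=> Hf; elim: n => [|n IH]; rewrite ?exprS; [exact: (vge_const 1)|exact: vgeMl]. Qed.

Lemma vge_horner m F x : (forall i, vge m F`_i) -> vge 0 x -> vge m F.[x].
Proof.
by move=> HF Hx; rewrite horner_coef; apply: vge_sum => i; apply: vgeMl => //; exact: vgeX.
Qed.

Lemma vge_deriv m F : (forall i, vge m F`_i) -> forall i, vge m F^`()`_i.
Proof.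
move=> HF i; rewrite coef_deriv; move: (F`_i.+1) (HF i.+1) => c Hc.
elim: (i.+1) => [|n IH]; first by rewrite mulr0n; exact: vge0.
by rewrite mulrS; exact: vgeD.
Qed.

(** Along Horner's scheme this builds the divided difference [D] of [F], which agrees with the
    derivative at [a] to the order [e] to which [x] and [y] agree with [a]. *)
Lemma horner_diff e F (a x y : L) : 0 <= e -> (forall i, vge 0 F`_i) ->
  vge 0 a -> vge e (x - a) -> vge e (y - a) ->
  exists2 D, F.[x] - F.[y] = (x - y) * D & vge e (D - F^`().[a]).
Proof.
move=> e0 HF Ha Hx Hy.
have Hx0 : vge 0 x by rewrite -(subrK a x); apply: vgeD => //; exact: vge_le Hx.
have Hy0 : vge 0 y by rewrite -(subrK a y); apply: vgeD => //; exact: vge_le Hy.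
suff [D [h1 h2 _]] : exists D, [/\ F.[x] - F.[y] = (x - y) * D, vge e (D - F^`().[a]) &
    vge e (F.[y] - F.[a])] by exists D.
elim/poly_ind: F HF => [|F c IH] HF.
  by exists 0; split; rewrite ?deriv0 ?horner0 ?mulr0 ?subrr //; exact: vge0.
have HF' i : vge 0 F`_i.
  by have := HF i.+1; rewrite coefD coefMX coefC /= addr0.
have [D [h1 h2 h3]] := IH HF'.
exists (D * x + F.[y]); rewrite !hornerMXaddC derivMXaddC hornerD hornerMX; split.
- have -> : F.[x] * x + c - (F.[y] * y + c) = (F.[x] - F.[y]) * x + F.[y] * (x - y) by ring.
  by rewrite h1; ring.
- have -> : D * x + F.[y] - (F.[a] + F^`().[a] * a) =
     (D - F^`().[a]) * x + F^`().[a] * (x - a) + (F.[y] - F.[a]) by ring.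
  apply: vgeD => //; apply: vgeD; first exact: vgeMl.
  by apply: vgeMr => //; apply: vge_horner => //; exact: vge_deriv.
- have -> : F.[y] * y + c - (F.[a] * a + c) = (F.[y] - F.[a]) * y + F.[a] * (y - a) by ring.
  apply: vgeD; first exact: vgeMl.
  by apply: vgeMr => //; exact: vge_horner.
Qed.

(** The coefficient at [d] is stable once [d < n.+1 * e], and the limit reads it at such a stage
    [N d]. Up to a bound [M] the limit agrees with the single series [y (N M)], whence
    left-finiteness. *)
Lemma lf_complete e (y : nat -> L) : 0 < e ->
  (forall n, vge (n.+1%:R * e) (y n.+1 - y n)) ->
  exists z : L, forall n, vge (n.+1%:R * e) (z - y n).
Proof.
move=> e0 Hy.
have stable n j d : d < n.+1%:R * e -> y (n + j)%N d = y n d.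
  move=> dn; elim: j => [|j IH]; first by rewrite addn0.
  have dnj : d < (n + j).+1%:R * e.
    by apply: lt_le_trans dn _; rewrite ler_pM2r // ler_nat ltnS leq_addr.
  have := Hy _ _ dnj; rewrite lfDE lfNE => /eqP; rewrite subr_eq0 addnS => /eqP ->.
  exact: IH.
have [N HN] : exists N : R -> nat, forall d, d < (N d).+1%:R * e.
  exists (fun d => Num.truncn (Num.max 0 (d / e))) => d.
  rewrite -ltr_pdivrMr //; apply: le_lt_trans (truncnS_gt _).
  by rewrite le_max lexx orbT.
have stable2 n d : d < n.+1%:R * e -> y (N d) d = y n d.
  move=> dn; have [le_n|/ltnW le_n] := leqP n (N d).
    by rewrite -(subnKC le_n) stable.
  by rewrite -(subnKC le_n) stable.
have lfz : left_finite (fun d => y (N d) d).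
  apply: left_finite_sub => M; have [s _ Hs] := lf_support (y (N M)) M.
  exists s => a; rewrite Hs => ya aM; rewrite aM andbT.
  by rewrite -(stable2 (N M)) // (le_lt_trans aM).
by exists (LFSeries lfz) => n d dn; rewrite lfDE lfNE /= (stable2 n) // subrr.
Qed.

Lemma vge_all e f : 0 < e -> (forall n, vge (n.+1%:R * e) f) -> f = 0.
Proof.
move=> e0 H; apply: lfext => d; rewrite lf0E; apply: (H (Num.truncn (Num.max 0 (d / e)))).
rewrite -ltr_pdivrMr //; apply: le_lt_trans (truncnS_gt _).
by rewrite le_max lexx orbT.
Qed.

(** Newton's iteration with the slope frozen at the constant [u], so that only an element of [K] is
    inverted. Convergence is linear: every step gains [e]. *)
Lemma hensel e F (k u : K) : 0 < e -> (forall i, vge 0 F`_i) ->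
  vge e F.[lfconst k] -> u != 0 -> vge e (F^`().[lfconst k] - lfconst u) ->
  exists2 z, root F z & vge e (z - lfconst k).
Proof.
move=> e0 HF Fk u0 Fu; have e0' := ltW e0.
set a := lfconst k; pose v := lfconst u^-1.
have uv : lfconst u * v = 1 by rewrite -rmorphM divff // rmorph1.
pose y n := iter n (fun y => y - v * F.[y]) a.
have Hy n : vge e (y n - a) /\ vge (n.+1%:R * e) F.[y n].
  elim: n => [|n [IH1 IH2]]; first by rewrite /y /= subrr mul1r; split => //; exact: vge0.
  have step : vge (n.+1%:R * e) (v * F.[y n]) by apply: vgeMr => //; exact: vge_const.
  have e_le : e <= n.+1%:R * e by rewrite ler_peMl // ler1n.
  have H1 : vge e (y n.+1 - a).
    rewrite /y iterS -/(y n) addrAC; apply: vgeB => //; exact: vge_le step.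
  split => //.
  have [D DE HD] := horner_diff e0' HF (vge_const k) H1 IH1.
  (* With [u v = 1], the new value is [F(y_n) (1 - v D) = F(y_n) v (u - D)], and [D] agrees with [u]
     to order [e]. *)
  have -> : F.[y n.+1] = F.[y n] * (v * (lfconst u - D)).
    rewrite -(subrK F.[y n] F.[y n.+1]) DE {1}/y iterS -/(y n).
    transitivity (F.[y n] * (lfconst u * v - v * D)); last by ring.
    by rewrite uv; ring.
  rewrite mulrSr mulrDl mul1r; apply: vgeM => //; apply: vgeMr; first exact: vge_const.
  rewrite -opprB; apply: vgeN.
  have -> : D - lfconst u = (D - F^`().[a]) + (F^`().[a] - lfconst u) by ring.
  exact: vgeD.
have [n|z Hz] := @lf_complete e y e0.
  rewrite /y iterS -/(y n) addrAC subrr sub0r; apply: vgeN.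
  by apply: vgeMr; [exact: vge_const|have [] := Hy n].
have Hza : vge e (z - a) by have := Hz 0%N; rewrite mul1r.
exists z => //; apply/eqP; apply: (@vge_all e) => // n.
have [Hn1 Hn2] := Hy n.
have [D DE HD] := horner_diff e0' HF (vge_const k) Hza Hn1.
rewrite -(subrK F.[y n] F.[z]) DE; apply: vgeD => //; apply: vgeMl => //.
rewrite -(subrK F^`().[a] D); apply: vgeD; first exact: vge_le HD.
by apply: vge_horner; [exact: vge_deriv|exact: vge_const].
Qed.

End Hensel.

(** * Factorization over series with left-finite support *)

Section Factorization.
Variables (R : realType) (K : fieldType).
Local Notation L := (lfseries R K).
Implicit Types (f : L) (F : {poly L}) (rs : seq L).

Lemma left_finite_hahn f : is_hahn f.
Proof.
move=> S Sf [b Sb].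
have [s us Hs] := lf_support f b.
have bs : b \in [seq x <- s | `[< S x >]].
  by rewrite mem_filter Hs lexx andbT; apply/andP; split; [exact/asboolP|exact: Sf].
have [a] := seq_min bs; rewrite mem_filter Hs => /andP[/asboolP Sa /andP[_ ab]] amin.
exists a; split => // x Sx; case: (leP x b) => xb; last exact: le_trans ab (ltW xb).
apply: amin; rewrite mem_filter Hs xb andbT.
by apply/andP; split; [exact/asboolP|exact: Sf].
Qed.

Lemma hval_uniq (f : R -> K) a b : hval f a -> hval f b -> a = b.
Proof. by move=> [fa Ha] [fb Hb]; apply/eqP; rewrite eq_le (Ha _ fb) (Hb _ fa). Qed.

Lemma hval0 a : ~ hval (0 : L) a.
Proof. by case; rewrite lf0E eqxx. Qed.

Lemma lfmonoM (k l : K) (a b : R) :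
  lfmono k a * lfmono l b = lfmono (k * l) (a + b) :> L.
Proof.
apply: lfext => x; rewrite lfME hmul_mono /= /hmono subr_eq addrC.
by case: ifP; rewrite ?mulr0.
Qed.

Lemma lfmonoX (a : R) n : lfmono 1 a ^+ n = lfmono 1 (n%:R * a) :> L.
Proof.
elim: n => [|n IH]; first by rewrite mul0r.
by rewrite exprS IH lfmonoM mulr1; congr lfmono; rewrite mulrSr; ring.
Qed.

Lemma lfmono0 a : lfmono 0 a = 0 :> L.
Proof. by apply: lfext => x; rewrite lf0E /= /hmono if_same. Qed.

Lemma lf_roots_prod F rs : uniq rs -> (forall r, r \in rs -> root F r) ->
  exists G : {poly L}, F = G * \prod_(r <- rs) ('X - r%:P).
Proof.
elim: rs F => [|r rs IH] F /=; first by exists F; rewrite big_nil mulr1.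
move=> /andP[rrs urs] H; have /factor_theorem [G FG] := H r (mem_head _ _).
have [s srs|G' GE] := IH G urs; last by exists G'; rewrite big_cons FG GE; ring.
have : root F s by apply: H; rewrite inE srs orbT.
rewrite FG /root hornerM hornerXsubC => /eqP /lf_mul_eq0 [->//|/eqP].
by rewrite subr_eq0 => /eqP sr; rewrite -sr srs in rrs.
Qed.

Lemma lf_roots_full F rs d : uniq rs -> (forall r, r \in rs -> root F r) ->
  size F = d.+1 -> (d <= size rs)%N ->
  F = (lead_coef F)%:P * \prod_(r <- rs) ('X - r%:P).
Proof.
move=> urs /(lf_roots_prod urs) [G FG] sF drs.
have mon : \prod_(r <- rs) ('X - r%:P) \is monic by apply: monic_prod => r _; exact: monicXsubC.
have G0 : G != 0.
  by apply/eqP => G0; move: sF; rewrite FG G0 mul0r size_poly0.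
have sG : size G = 1%N.
  have := sF; rewrite FG size_Mmonic // size_prod_XsubC addnS /= => e.
  apply/eqP; rewrite eqn_leq size_poly_gt0 G0 andbT -(leq_add2r (size rs)) e.
  by rewrite add1n ltnS.
have -> : lead_coef F = lead_coef G by rewrite FG lead_coef_Mmonic.
have GE : G = (G`_0)%:P by apply: size1_polyC; rewrite sG.
by rewrite [in lead_coef _]GE lead_coefC -GE.
Qed.

(** Carries factorizations in [{poly L}] over to coefficient lists. The length is proved along,
    because [mul_lin] enumerates the coefficients by it. *)
Lemma prod_linE rs k :
  hcoef (prod_lin (map (@lfval R K) rs)) k = (\prod_(r <- rs) ('X - r%:P))`_k.
Proof.
suff [-> //] : (forall k, hcoef (prod_lin (map (@lfval R K) rs)) k = (\prod_(r <- rs) ('X - r%:P))`_k)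
  /\ size (prod_lin (map (@lfval R K) rs)) = (size rs).+1.
elim: rs => [|r rs [IH IHs]] /=.
  split=> // -[|j]; rewrite big_nil coef1 /hcoef /=.
    by apply: funext.
  by rewrite nth_nil; apply: funext => x; rewrite -[RHS]/((0 : L) x) lf0E.
split; last by rewrite size_map size_iota IHs.
move=> j; rewrite big_cons mulrBl coefB coefXM coefCM /mul_lin IHs.
have sp : size (\prod_(r <- rs) ('X - r%:P)) = (size rs).+1 by rewrite size_prod_XsubC.
have [jn|nj] := ltnP j (size rs).+2; last first.
  rewrite /hcoef nth_default ?size_map ?size_iota //.
  case: j nj => // j nj.
  have p1 : (\prod_(r <- rs) ('X - r%:P))`_j = 0 by apply: nth_default; rewrite sp.
  have p2 : (\prod_(r <- rs) ('X - r%:P))`_j.+1 = 0 by apply: nth_default; rewrite sp ltnW.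
  by rewrite p2 mulr0 subr0 /= p1; apply: funext => x; rewrite lf0E.
rewrite {1}/hcoef (nth_map 0%N) ?size_iota // nth_iota // add0n.
rewrite (_ : hcoef _ j = (\prod_(r <- rs) ('X - r%:P))`_j); last exact: IH.
apply: funext => x; rewrite /hsub lfDE lfNE lfME; congr (_ - _).
case: j {jn} => [|j]; first by rewrite lf0E.
by rewrite (_ : hcoef _ j.+1.-1 = (\prod_(r <- rs) ('X - r%:P))`_j) //; exact: IH.
Qed.

End Factorization.

(** * The lift *)

Section Lift.
Variables (R : realType) (p : seq (TR R)).
Local Notation C := R[i].
Local Notation L := (lfseries R C).
Local Notation toC := (real_complex R).
Local Notation n := (size p).
Implicit Types (i j k : nat) (lam mu : R).

(** The summand 2 ensures [B > 1] for the empty list too. *)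
Definition lift_base : R := n%:R ^+ 3 + 2.
Local Notation B := lift_base.

Let B1 : 1 < B.
Proof. by have : 0 <= n%:R ^+ 3 :> R by [rewrite exprn_ge0]; rewrite /lift_base; lra. Qed.

Let Bn : n%:R ^+ 3 < B.
Proof. by rewrite ltrDl ltr0n. Qed.

Definition tsign k : option bool := if tcoef p k is TFin s _ then Some s else None.
Definition tval k : option R := if tcoef p k is TFin _ v then Some v else None.

Definition lift_lead k : R := sep_coef B tsign k.
(** The default exponent 0 occurs only beside a zero coefficient. *)
Definition lift_exp k : R := odflt 0 (tval k).
Local Notation c := lift_lead.
Local Notation v := lift_exp.

Lemma tval_default k : (n <= k)%N -> tval k = None.
Proof. by move=> nk; rewrite /tval /tcoef nth_default. Qed.

Lemma lift_coef_eq0 k : (c k == 0) = (tval k == None).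
Proof.
have := sep_coef_sign B1 tsign k; rewrite -/(lift_lead k) /sign_of /tsign /tval.
by case: ifP => _; case: (tcoef p k).
Qed.

Lemma lift_coef_out k : (n <= k)%N -> c k = 0.
Proof. by move/tval_default => vk; apply/eqP; rewrite lift_coef_eq0 vk. Qed.

Definition lift : seq (R -> R) := [seq hmono (c k) (v k) | k <- iota 0 n].

Lemma lift_coef k : hcoef lift k = hmono (c k) (v k).
Proof.
have [kn|nk] := ltnP k n.
  by rewrite /hcoef (nth_map 0%N) ?size_iota // nth_iota.
rewrite /hcoef nth_default ?size_map ?size_iota // lift_coef_out //.
by apply: funext => x; rewrite /hmono if_same.
Qed.

Lemma lift_hval k x : hval (hcoef lift k) x <-> tval k = Some x.
Proof.
rewrite lift_coef /hval /hmono; have := lift_coef_eq0 k; rewrite /lift_exp.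
case: (tval k) => [w|] /= ck; split.
- by case; have [->|] := eqVneq x w; rewrite ?eqxx.
- by case=> <-; rewrite eqxx ck; split => // d; have [->|] := eqVneq d w; rewrite ?eqxx.
- by case; rewrite (eqP ck) if_same eqxx.
- by [].
Qed.

Lemma lift_vR k : vR (hcoef lift k) (tcoef p k).
Proof.
case pk : (tcoef p k) => [|s w].
  left; split => // g; have /eqP ck : c k == 0 by rewrite lift_coef_eq0 /tval pk.
  by rewrite lift_coef /hmono ck if_same.
have vk : tval k = Some w by rewrite /tval pk.
right; exists w; split; first exact/lift_hval.
have := sep_coef_sign B1 tsign k; rewrite {2}/tsign pk -/(lift_lead k) /sign_of.
by case: eqP => // _ [<-]; rewrite lift_coef /hmono /lift_exp vk eqxx.
Qed.

Lemma lift_newton i j lam : newton_edge lift i j lam <-> hull_edge tval i j lam.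
Proof.
split=> -[ij [vi [vj [Vi [Vj [lamE H]]]]]]; split=> //; exists vi, vj.
  by split; [exact/lift_hval|split; [exact/lift_hval|split=> // k vk /lift_hval/H]].
by split; [exact/lift_hval|split; [exact/lift_hval|split=> // k vk /lift_hval/H]].
Qed.

Definition lift_poly : {poly L} := \poly_(k < n) lfmono (toC (c k)) (v k).

Lemma lift_poly_coef k : lift_poly`_k = lfmono (toC (c k)) (v k).
Proof. by rewrite coef_poly; case: ltnP => // /lift_coef_out ->; rewrite rmorph0 lfmono0. Qed.

(** * The roots lifted from one edge *)

Section Edge.
Variables (i j : nat) (lam mu : R).
Hypotheses (ij : (i < j)%N)
  (Vi : tval i = Some (mu + i%:R * lam)) (Vj : tval j = Some (mu + j%:R * lam))
  (Vge : forall k vk, tval k = Some vk -> mu + k%:R * lam <= vk)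
  (Von : forall k, tval k = Some (mu + k%:R * lam) -> (i <= k <= j)%N).

(** An edge of slope [lam] has roots of valuation [- lam]. At [a] the terms of [p] on the edge have
    valuation [mu] and the others a larger one; [sg] keeps the signs of the former. *)
Let a : TR R := TFin true (- lam).
Let sg k : option bool := sign_at mu (tshift (k%:R * - lam) (tcoef p k)).

Lemma edge_sign k : sg k = if tval k == Some (mu + k%:R * lam) then tsign k else None.
Proof.
rewrite /sg /tval /tsign; case: (tcoef p k) => //= s w.
by rewrite mulrN subr_eq.
Qed.

Lemma edge_coef k :
  sep_coef B sg k = if tval k == Some (mu + k%:R * lam) then c k else 0.
Proof. by rewrite /lift_lead /sep_coef edge_sign; case: ifP. Qed.

Lemma edge_val_ge k : c k != 0 -> 0 <= v k - k%:R * lam - mu.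
Proof.
rewrite lift_coef_eq0 /v; case vk : (tval k) => [w|] //= _.
by have := Vge vk; lra.
Qed.

Lemma edge_terms : map (sign_at mu) (teval_terms p a) = [seq sg k | k <- iota 0 n].
Proof. by rewrite teval_termsE -map_comp. Qed.

Lemma edge_terms_ge : all (val_ge mu) (teval_terms p a).
Proof.
rewrite teval_termsE all_map; apply/allP => k _ /=.
have := @Vge k; rewrite /tval; case: (tcoef p k) => //= s w /(_ _ erefl); lra.
Qed.

Lemma tneg_coef k : tcoef (tneg_var p) k =
  if odd k then topp (tcoef p k) else tcoef p k.
Proof.
have texpN m : texp (topp (tone R)) m = TFin (~~ odd m) 0.
  by elim: m => //= m ->; rewrite /= addr0; case: odd.
have [kn|nk] := ltnP k n; last first.
  by rewrite /tcoef !nth_default ?size_map ?size_iota //; case: odd.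
rewrite {1}/tcoef (nth_map 0%N) ?size_iota // nth_iota // add0n texpN.
by case: (tcoef p k) => [|s w] /=; case: odd => //=; rewrite add0r; case: s.
Qed.

Lemma edge_terms_neg : map (sign_at mu) (teval_terms (tneg_var p) a) =
  [seq sign_twist sg k | k <- iota 0 n].
Proof.
rewrite teval_termsE -map_comp size_map size_iota; apply: eq_map => k /=.
rewrite tneg_coef /sign_twist /sg; case: odd => //.
by rewrite tshift_opp sign_at_opp.
Qed.

Lemma edge_terms_neg_ge : all (val_ge mu) (teval_terms (tneg_var p) a).
Proof.
rewrite teval_termsE all_map size_map size_iota; apply/allP => k _ /=.
rewrite tneg_coef; have := @Vge k; rewrite /tval.
by case: odd; case: (tcoef p k) => //= s w /(_ _ erefl); lra.
Qed.

Lemma edge_sign_fst : sg i <> None.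
Proof. by rewrite edge_sign Vi eqxx; move: Vi; rewrite /tval /tsign; case: tcoef. Qed.

Lemma edge_sign_snd : sg j <> None.
Proof. by rewrite edge_sign Vj eqxx; move: Vj; rewrite /tval /tsign; case: tcoef. Qed.

Lemma edge_lt_size : (j < n)%N.
Proof. by rewrite ltnNge; apply/negP => /tval_default; rewrite Vj. Qed.

Lemma edge_sign_in k : sg k <> None -> (i <= k <= j)%N.
Proof. by rewrite edge_sign; case: eqP => // /Von. Qed.

Lemma edge_tmult :
  tmult a p = sign_changes None [seq sg k | k <- iota 0 n] /\
  tmult a (tneg_var p) = sign_changes None [seq sign_twist sg k | k <- iota 0 n].
Proof.
have i_in : i \in iota 0 n by rewrite mem_iota /= add0n (ltn_trans ij) // edge_lt_size.
have si : isSome (sg i) by case: (sg i) edge_sign_fst.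
split.
  rewrite (tmult_sign_changes edge_terms_ge) edge_terms //.
  by apply/hasP; exists (sg i) => //; exact: map_f.
rewrite (tmult_sign_changes edge_terms_neg_ge) edge_terms_neg //.
apply/hasP; exists (sign_twist sg i); first exact: map_f.
by rewrite /sign_twist; case: odd => //; case: (sg i) si.
Qed.

(** Finitely many coefficients lie off the edge, so their heights above it are bounded away from 0;
    this bound is the precision [e] in Hensel's lemma. *)
Lemma edge_gap : exists2 e : R, 0 < e &
  forall k, c k != 0 -> 0 < v k - k%:R * lam - mu -> e <= v k - k%:R * lam - mu.
Proof.
pose E k := v k - k%:R * lam - mu.
have [e e0 He] : exists2 e : R, 0 < e & forall k, (k < n)%N -> 0 < E k -> e <= E k.
  elim: (n) => [|m [e e0 He]]; first by exists 1.
  have [Em|Em] := ltP 0 (E m).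
    exists (Num.min e (E m)); first by rewrite lt_min e0.
    move=> k; rewrite ltnS leq_eqVlt => /orP[/eqP ->|/He H] Ek.
      by rewrite ge_min lexx orbT.
    by rewrite ge_min H.
  exists e => // k; rewrite ltnS leq_eqVlt => /orP[/eqP -> Ek|/He //].
  by have := lt_le_trans Ek Em; rewrite ltxx.
exists e => // k ck; apply: He; rewrite ltnNge; apply: contra ck => /lift_coef_out ->.
by rewrite eqxx.
Qed.

(** Setting [x = t^(-lam) y] and dividing by [t^mu] turns the lift into [G], with coefficients of
    valuation at least 0 and the initial form [F] as residue; a simple root of [F] is what [hensel]
    needs. *)
Lemma edge_root (z : C) : z != 0 ->
  root (map_poly toC (sep_poly n B sg)) z ->
  ~~ root (map_poly toC (sep_poly n B sg))^`() z ->
  exists r : L, [/\ root lift_poly r, hval r (- lam) & r (- lam) = z].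
Proof.
set F := map_poly toC _ => z0 rz drz; have [e e0 He] := edge_gap.
pose G : {poly L} := \poly_(k < n) lfmono (toC (c k)) (v k - k%:R * lam - mu).
have Gc k : G`_k = lfmono (toC (c k)) (v k - k%:R * lam - mu).
  by rewrite coef_poly; case: ltnP => // /lift_coef_out ->; rewrite rmorph0 lfmono0.
pose cst := @lfconst R C.
have Fc k : F`_k = toC (sep_coef B sg k).
  rewrite coef_map coef_poly; case: ltnP => // nk.
  by rewrite edge_coef lift_coef_out // if_same rmorph0.
have toC0 : toC 0 = 0 by [].
have cst0 : cst 0 = 0 by exact: lfmono0.
have cstF k : (map_poly cst F)`_k = cst F`_k by rewrite coef_map.
(* The contribution of the coefficients off the edge. *)
pose H := G - map_poly cst F.
have Hc k : vge e H`_k.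
  rewrite coefB cstF Gc Fc edge_coef.
  have [ck|ck] := eqVneq (c k) 0.
    by rewrite ck if_same toC0 lfmono0 cst0 subr0; exact: vge0.
  have ge0 := edge_val_ge ck; case: eqP => vk.
    rewrite (_ : v k - k%:R * lam - mu = 0) ?subrr; first exact: vge0.
    by rewrite /lift_exp vk /=; ring.
  rewrite toC0 cst0 subr0; apply: vge_mono; apply: He => //.
  rewrite lt_neqAle ge0 andbT eq_sym; apply: contra_notN vk => /eqP vk.
  move: ck; rewrite lift_coef_eq0 /lift_exp in vk *; case: (tval k) vk => [w|] //= vk _.
  by congr Some; lra.
have GE : G = map_poly cst F + H by rewrite /H addrC subrK.
have Gge k : vge 0 G`_k.
  rewrite GE coefD cstF; apply: vgeD; first exact: vge_const.
  by apply: vge_le (Hc k); exact: ltW.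
have [|||y ry hy] := @hensel _ _ e G z F^`().[z] e0 Gge.
- rewrite GE hornerD horner_map (rootP rz) raddf0 add0r.
  by apply: vge_horner => //; exact: vge_const.
- by move: drz; rewrite rootE.
- rewrite GE derivD hornerD deriv_map horner_map addrAC subrr add0r.
  by apply: vge_horner; [exact: vge_deriv|exact: vge_const].
have y0 : y 0 = z.
  by have := hy 0 e0; rewrite lfDE lfNE /= /hmono eqxx => /eqP; rewrite subr_eq0 => /eqP.
have rE x : (lfmono 1 (- lam) * y) x = y (x + lam) by rewrite lfME hmul_mono mul1r opprK.
exists (lfmono 1 (- lam) * y); split.
- have -> : root lift_poly (lfmono 1 (- lam) * y) = (lfmono 1 mu * G.[y] == 0).
    rewrite rootE !horner_poly mulr_sumr; congr (_ == 0); apply: eq_bigr => k _.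
    rewrite exprMn lfmonoX !mulrA !lfmonoM mulr1 mul1r; congr (lfmono _ _ * _); ring.
  by rewrite (rootP ry) mulr0.
- split; first by rewrite rE addNr y0.
  move=> d; rewrite rE => yd.
  have : vge 0 y.
    rewrite -(subrK (cst z) y); apply: vgeD; last exact: vge_const.
    by apply: vge_le hy; exact: ltW.
  by move/vgeP => /(_ _ yd); lra.
- by rewrite rE addNr.
Qed.

Definition positive_root (r : R -> C) : bool :=
  `[< hval r (- lam) /\ complex.Im (r (- lam)) = 0 /\ 0 < complex.Re (r (- lam)) >].
Definition negative_root (r : R -> C) : bool :=
  `[< hval r (- lam) /\ complex.Im (r (- lam)) = 0 /\ complex.Re (r (- lam)) < 0 >].

(** The lifts are distinct because their leading coefficients are the distinct roots of the initial
    form, on which the sign conditions are read off. *)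
Lemma edge_roots : exists rs : seq L, [/\ uniq rs, size rs = (j - i)%N,
  (forall r, r \in rs -> root lift_poly r /\ hval r (- lam)),
  count positive_root (map (@lfval R C) rs) = tmult a p &
  count negative_root (map (@lfval R C) rs) = tmult a (tneg_var p)].
Proof.
have [zs [uzs szs Hzs pos neg]] := sep_edge_roots B1 Bn ij edge_lt_size
  edge_sign_fst edge_sign_snd edge_sign_in.
have /choice [f Hf] : forall z, exists r : L, z \in zs ->
    [/\ root lift_poly r, hval r (- lam) & r (- lam) = z].
  move=> z.
  have [zzs|_] := boolP (z \in zs); last by exists 0.
  by have [h1 h2 h3] := Hzs z zzs; have [r Hr] := edge_root h1 h2 h3; exists r.
have [t1 t2] := edge_tmult.
exists (map f zs); split.
- rewrite map_inj_in_uniq // => x y xzs yzs e.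
  by have [_ _ <-] := Hf x xzs; have [_ _ <-] := Hf y yzs; rewrite e.
- by rewrite size_map.
- by move=> r /mapP[z /Hf[h1 h2 _] ->].
- rewrite t1 -pos -map_comp count_map; apply: eq_in_count => z /Hf [_ h2 h3] /=.
  rewrite /positive_root h3; apply/asboolP/andP => [[_ [/eqP -> ->]]//|[/eqP ? ?]].
  by split.
- rewrite t2 -neg -map_comp count_map; apply: eq_in_count => z /Hf [_ h2 h3] /=.
  rewrite /negative_root h3; apply/asboolP/andP => [[_ [/eqP -> ->]]//|[/eqP ? ?]].
  by split.
Qed.

End Edge.

(** * Assembling the edges *)

Lemma hcomplex_mono (x y : R) : hcomplex (hmono x y) = hmono (toC x) y.
Proof. by apply: funext => z; rewrite /hcomplex /hmono; case: ifP. Qed.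

Lemma flatten_map_uniq (S T : eqType) (E : seq S) (h : S -> seq T) : uniq E ->
  (forall e, e \in E -> uniq (h e)) ->
  (forall e e' r, e \in E -> e' \in E -> r \in h e -> r \in h e' -> e = e') ->
  uniq (flatten (map h E)).
Proof.
elim: E => //= e E IH /andP[eE uE] Hu Hd.
rewrite cat_uniq Hu ?mem_head //= IH //; last 2 first.
- by move=> e' e'E; apply: Hu; rewrite inE e'E orbT.
- by move=> e1 e2 r h1 h2; apply: Hd; rewrite inE ?h1 ?h2 orbT.
rewrite andbT; apply/hasPn => r /flatten_mapP[e' e'E re']; apply/negP => re.
have ee' : e = e' by apply: (Hd _ _ r) => //; rewrite inE ?eqxx // e'E orbT.
by rewrite ee' e'E in eE.
Qed.

Lemma count_flatten_map (S T : eqType) (E : seq S) (h : S -> seq T) (q : pred T) e :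
  uniq E -> e \in E ->
  (forall e' r, e' \in E -> r \in h e' -> q r -> e' = e) ->
  count q (flatten (map h E)) = count q (h e).
Proof.
move=> uE eE H; rewrite count_flatten sumnE !big_map (bigD1_seq e) //=.
rewrite big1_seq ?addn0 // => e' /andP[e'e e'E].
apply/eqP; rewrite -leqn0 leqNgt -has_count; apply/hasPn => r re'; apply/negP => qr.
by rewrite (H _ _ e'E re' qr) eqxx in e'e.
Qed.

Lemma lift_factor : exists (lc : R -> R) (rs : seq L),
  [/\ is_hahn lc,
    (forall k, hcomplex (hcoef lift k) =
       hmul (hcomplex lc) (hcoef (prod_lin (map (@lfval R C) rs)) k)) &
    forall i j lam, hull_edge tval i j lam ->
      count (positive_root lam) (map (@lfval R C) rs) = tmult (TFin true (- lam)) p /\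
      count (negative_root lam) (map (@lfval R C) rs) =
        tmult (TFin true (- lam)) (tneg_var p)].
Proof.
have hmono_hahn (x y : R) : is_hahn (hmono x y) by exact: (@left_finite_hahn R R (lfmono x y)).
(* If every coefficient of [p] is infinite, the lift is zero: the constant 0, no roots and no
   edges. *)
have [none|some] := pselect (forall k, tval k = None).
  exists (hmono 0 0), [::]; split => // [k|i j lam]; last first.
    by case=> _ [vi [vj []]]; rewrite none.
  have /eqP ck : c k == 0 by rewrite lift_coef_eq0 none.
  rewrite lift_coef ck !hcomplex_mono; apply: funext => x.
  by rewrite hmul_mono mul0r /hmono if_same.
have exv : exists k, tval k != None.
  by apply: contrapT => H; apply: some => k; apply/eqP; apply: contrapT => /negP vk; apply: H; exists k.
have v_n k : tval k != None -> (k <= n)%N.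
  by apply: contraNT; rewrite -ltnNge => /ltnW /tval_default ->.
case: (ex_minnP exv) => m vm m_min; case: (ex_maxnP exv v_n) => d vd d_max.
have md : (m <= d)%N by apply: d_max.
have dn : (d < n)%N by rewrite ltnNge; apply: contra vd => /tval_default ->.
pose E := [seq ij <- [seq (i, j) | i <- iota 0 n, j <- iota 0 n] |
  `[< exists lam, hull_edge tval ij.1 ij.2 lam >]].
have uE : uniq E.
  by rewrite filter_uniq // allpairs_uniq ?iota_uniq // => -[? ?] [? ?].
have inE' i j lam : hull_edge tval i j lam -> (i, j) \in E.
  move=> H; rewrite mem_filter; apply/andP; split; first by apply/asboolP; exists lam.
  have Hn k : tval k <> None -> k \in iota 0 n.
    by move=> vk; rewrite mem_iota /= add0n ltnNge; apply/negP => /tval_default.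
  by case: H => _ [vi [vj [Vi [Vj _]]]]; apply: allpairs_f; apply: Hn; rewrite ?Vi ?Vj.
have /choice [h Hh] : forall ij : nat * nat, exists x : R * seq L, ij \in E ->
    hull_edge tval ij.1 ij.2 x.1 /\
    [/\ uniq x.2, size x.2 = (ij.2 - ij.1)%N,
     (forall r, r \in x.2 -> root lift_poly r /\ hval r (- x.1)),
     count (positive_root x.1) (map (@lfval R C) x.2) = tmult (TFin true (- x.1)) p &
     count (negative_root x.1) (map (@lfval R C) x.2) =
       tmult (TFin true (- x.1)) (tneg_var p)].
  move=> [i j]; have [|_] := boolP ((i, j) \in E); last by exists (0, [::]).
  rewrite mem_filter => /andP[/asboolP [lam Hlam] _].
  have [mu [Vi Vj Vge Von]] := hull_edge_line Hlam.
  have [rs Hrs] := edge_roots Hlam.1 Vi Vj Vge Von.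
  by exists (lam, rs).
pose rs := flatten [seq (h e).2 | e <- E].
(* The valuation of a lifted root gives the slope of its edge, and a slope determines the edge; so
   different edges give disjoint lists. *)
have Hd e e' r : e \in E -> e' \in E -> r \in (h e).2 -> hval r (- (h e').1) -> e = e'.
  move=> eE e'E re re'.
  have [He [_ _ /(_ r re)[_ hr] _ _]] := Hh e eE; have [He' _] := Hh e' e'E.
  have /oppr_inj el := hval_uniq hr re'; rewrite el in He.
  by have := hull_edge_uniq He He'; case: (e) (e') => ? ? [? ?] /= [-> ->].
have urs : uniq rs.
  apply: (@flatten_map_uniq _ _ E (fun e => (h e).2)) => //.
    by move=> e /Hh [_ []].
  move=> e e' r eE e'E re re'; apply: (Hd e e' r) => //.
  by have [_ [_ _ /(_ r re')[]]] := Hh e' e'E.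
have rs_root r : r \in rs -> root lift_poly r /\ r != 0.
  move=> /flatten_mapP[e eE re]; have [_ [_ _ /(_ r re)[rr hr] _ _]] := Hh e eE.
  by split => //; apply/eqP => r0; apply: (@hval0 R C (- (h e).1)); rewrite -r0.
(* Double counting of the pairs of an edge and a unit step below it: every step has an edge, and an
   edge from [i] to [j] has at most [j - i] steps. *)
have rs_size : (d - m <= size rs)%N.
  rewrite size_flatten /shape -map_comp sumnE big_map.
  apply: leq_trans (_ : \sum_(e <- E) \sum_(k <- iota m (d - m)) (e.1 <= k < e.2)%N <= _)%N.
    rewrite exchange_big /= -{1}(size_iota m (d - m)) -sum1_size !big_seq.
    apply: leq_sum => k; rewrite mem_iota subnKC // => mkd.
    have [||i [j [lam [ijk Hij]]]] := hull_cover tval_default mkd; try exact/eqP.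
    by rewrite (bigD1_seq (i, j)) ?(inE' _ _ _ Hij) //= ijk.
  rewrite !big_seq; apply: leq_sum => e /Hh [_ [_ /= -> _ _ _]].
  have -> : (\sum_(k <- iota m (d - m)) (e.1 <= k < e.2) =
      count (fun k => e.1 <= k < e.2) (iota m (d - m)))%N.
    by rewrite -sum1_count [RHS]big_mkcond; apply: eq_bigr => k _; case: (e.1 <= k < e.2)%N.
  rewrite -size_filter -(size_iota e.1 (e.2 - e.1)).
  apply: uniq_leq_size; first by rewrite filter_uniq ?iota_uniq.
  by move=> k; rewrite mem_filter mem_iota => /andP[ek _]; rewrite mem_iota; lia.
have PLm : lift_poly = drop_poly m lift_poly * 'X^m.
  rewrite -[LHS](poly_take_drop m) -[RHS]add0r; congr (_ + _).
  apply/polyP => k; rewrite coef_take_poly coef0; case: ltnP => // km.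
  rewrite lift_poly_coef (_ : c k = 0) ?lfmono0 //; apply/eqP; rewrite lift_coef_eq0.
  by apply: contraLR km => /m_min; rewrite -leqNgt.
have vneq0 k : tval k != None -> lift_poly`_k != 0.
  move=> vk; rewrite lift_poly_coef; apply/eqP => /(congr1 (fun f : L => f (v k))).
  rewrite lf0E /= /hmono eqxx => /eqP; rewrite (fmorph_eq0 toC) lift_coef_eq0.
  by rewrite (negbTE vk).
have sPL : size lift_poly = d.+1.
  apply/eqP; rewrite eqn_leq; apply/andP; split.
    apply/leq_sizeP => k dk; rewrite lift_poly_coef (_ : c k = 0) ?lfmono0 //.
    by apply/eqP; rewrite lift_coef_eq0; apply: contraLR dk => /d_max; rewrite -leqNgt.
  rewrite ltnNge; apply/negP => /leq_sizeP /(_ d (leqnn _)) /eqP.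
  by rewrite (negbTE (vneq0 _ vd)).
have sQ : size (drop_poly m lift_poly) = (d - m).+1.
  by rewrite size_drop_poly sPL subSn.
have Qroot r : r \in rs -> root (drop_poly m lift_poly) r.
  move=> /rs_root [rr r0]; have rX k : r ^+ k <> 0.
    elim: k => [|k IH]; first by move/eqP; rewrite expr0 oner_eq0.
    by rewrite exprS => /lf_mul_eq0 [/eqP r0'|/IH //]; rewrite r0' in r0.
  move: rr; rewrite {1}PLm rootE hornerM hornerXn => /eqP /lf_mul_eq0 [Hr|/rX //].
  by rewrite rootE Hr.
have QE := lf_roots_full urs Qroot sQ rs_size.
have lQ : lead_coef (drop_poly m lift_poly) = lfmono (toC (c d)) (v d).
  by rewrite lead_coefE sQ coef_drop_poly subnK // lift_poly_coef.
(* The factor [X^m] contributes [m] roots 0, which have no valuation and are counted on no edge. *)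
exists (hmono (c d) (v d)), (rs ++ nseq m 0); split => //.
- move=> k; rewrite lift_coef !hcomplex_mono prod_linE.
  have -> : \prod_(r <- rs ++ nseq m 0) ('X - r%:P) = \prod_(r <- rs) ('X - r%:P) * 'X^m :> {poly L}.
    by rewrite big_cat; congr (_ * _); rewrite big_nseq subr0 -Monoid.iteropE.
  have := lift_poly_coef k; rewrite {1}PLm QE lQ -mulrA coefCM => /(congr1 (@lfval R C)) H.
  exact: esym H.
- move=> i j lam Hij; have eE := inE' _ _ _ Hij.
  have [He [_ _ _ pos neg]] := Hh _ eE.
  have lamE : (h (i, j)).1 = lam.
    move: He Hij => [_ [vi [vj [/= Vi [Vj [-> _]]]]]] [_ [wi [wj [Wi [Wj [-> _]]]]]].
    by move: Vi Vj; rewrite Wi Wj => -[->] [->].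
  rewrite lamE in pos neg.
  have countE (q : pred (R -> C)) : (forall f, q f -> hval f (- lam)) ->
      count q (map (@lfval R C) (rs ++ nseq m 0)) = count q (map (@lfval R C) (h (i, j)).2).
    move=> Hq; rewrite map_cat count_cat !count_map count_nseq /=.
    have /negbTE -> : ~~ q (0 : L) by apply/negP => /Hq /hval0.
    rewrite mul0n addn0; apply: (@count_flatten_map _ _ E (fun e => (h e).2)) => //.
    by move=> e r eEE re /Hq hr; apply: (Hd e (i, j) r) => //; rewrite lamE.
  by rewrite !countE ?pos ?neg // => f /asboolP [].
Qed.

End Lift.

Theorem theorem5p4 (R : realType) (p : seq (TR R)) :
  exists P : seq (R -> R),
    (forall c, c \in P -> is_hahn c) /\
    size P = size p /\
    (forall i, vR (hcoef P i) (tcoef p i)) /\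
    (* the roots of P in C[[t^R]], listed with multiplicity *)
    exists (lc : R -> R) (rs : seq (R -> R[i])),
      is_hahn lc /\ (forall r, r \in rs -> is_hahn r) /\
      (forall i, hcomplex (hcoef P i) =
                 hmul (hcomplex lc) (hcoef (prod_lin rs) i)) /\
      forall (i j : nat) (lam : R), newton_edge P i j lam ->
        let a := TFin true (- lam) in
        count (fun r => `[< hval r (tabs a) /\
                          complex.Im (r (tabs a)) = 0 /\ 0 < complex.Re (r (tabs a)) >]) rs
          = tmult a p /\
        count (fun r => `[< hval r (tabs a) /\
                          complex.Im (r (tabs a)) = 0 /\ complex.Re (r (tabs a)) < 0 >]) rs
          = tmult a (tneg_var p).
Proof.
exists (lift p); split.
  by move=> c /mapP[k _ ->]; exact: (@left_finite_hahn R R (lfmono _ _)).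
split; first by rewrite size_map size_iota.
split; first exact: lift_vR.
have [lc [rs [hlc Hk Hedge]]] := lift_factor p.
exists lc, (map (@lfval R R[i]) rs); split => //; split.
  by move=> r /mapP[f _ ->]; exact: left_finite_hahn.
by split => // i j lam /lift_newton /Hedge.
Qed.
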